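(* Assume that $\langle \alpha+2\rho,\beta\rangle\neq 0$ for all $\alpha\in\pi(\Lambda)$ and all $\beta\in\pi(\Lambda)\setminus\{0\}$. Then every simple $\Lambda$-graded $\mathcal A\mathcal V_\pi$-module $T$ of finite rank over $\mathcal A_\pi$ is isomorphic to $\mathcal M^n(\Gamma)$ for some integer $n\ge0$ and some $\Gamma\in\mathbb C^2/\pi(\Lambda)$.
   Context: Let $N>1$, $\Lambda=\mathbb Z^N$, $\rho=(1,1)\in\mathbb C^2$, and let $\langle\cdot,\cdot\rangle$ be the standard symplectic form on $\mathbb C^2$, $\langle(a,b),(c,d)\rangle=ad-bc$. Let $\pi:\Lambda\hookrightarrow\mathbb C^2$ be an injective additive map such that (i) $\pi(\Lambda)\not\subset\mathbb C\rho$; (ii) $2\rho\notin\pi(\Lambda)$; (iii) $\pi(\Lambda)$ does not lie in a complex line. $\mathcal S=\bigoplus_{\lambda\in\mathbb C^2}\mathbb C L_\lambda$ is the Poisson algebra with commutative product $L_\lambda\cdot L_\mu=L_{\lambda+\mu+\rho}$ and bracket $\{L_\lambda,L_\mu\}=\langle\lambda+\rho,\mu+\rho\rangle L_{\lambda+\mu}$. $W_\pi\subset\mathcal S$ is the Lie subalgebra with basis $(L_\lambda)_{\lambda\in\pi(\Lambda)}$, and $\mathcal A_\pi=\bigoplus_{\lambda\in\pi(\Lambda)}\mathbb C L_{\lambda-\rho}$ is a commutative subalgebra with unit $L_{-\rho}$, isomorphic to $\mathbb C[t_1^{\pm1},\dots,t_N^{\pm1}]$. An $\mathcal A\mathcal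 V_\pi$-module is a vector space $T$ that is both a module over the unital commutative algebra $\mathcal A_\pi$ (action $\theta^{\mathcal A}$) and over the Lie algebra $W_\pi$ (action $\theta^{\mathcal V}$), such that $\theta^{\mathcal V}(L_\lambda)\theta^{\mathcal A}(L_{\mu-\rho})=\theta^{\mathcal A}(\{L_\lambda,L_{\mu-\rho}\})+\theta^{\mathcal A}(L_{\mu-\rho})\theta^{\mathcal V}(L_\lambda)$ for $\lambda,\mu\in\pi(\Lambda)$. It is $\Lambda$-graded if there is a coset $\Gamma\in\mathbb C^2/\pi(\Lambda)$ with $T=\bigoplus_{\mu\in\Gamma}T_\mu$, $T_\mu=\{v\in T:\theta^{\mathcal V}(L_0)v=\langle\rho,\mu\rangle v\}$. Finite rank over $\mathcal A_\pi$ means that the homogeneous components are finite-dimensional, i.e. $T$ is a free $\mathcal A_\pi$-module of finite rank. Let $V=\mathbb C^2$. The symmetric algebra $S^\bullet V$ carries the Poisson bracket determined by $\{\alpha,\beta\}=\langle\alpha,\beta\rangle 1$ for $\alpha,\beta\in V$. For $n\ge0$ and $\Gamma\in\mathbb C^2/\pi(\Lambda)$, $\mathcal M^n(\Gamma)=\bigoplus_{\mu\in\Gamma}L_\mu\otimes S^nV$ is the $\mathcal A\mathcal V_\pi$-module with $$L_\lambda.(L_\mu\otimes u)=\langle\lambda+\rho,\mu+\rho\rangle L_{\lambda+\mu}\otimes u+\tfrac12 L_{\lambda+\mu}\otimes\{\lambda(\lambda+\rho),u\}\quad (L_\lambda\in W_\pi),$$ $$L_{\lambda-\rho}.(L_\mu\otimes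 u)=L_{\lambda+\mu}\otimes u\quad (L_{\lambda-\rho}\in\mathcal A_\pi),$$ for $\lambda\in\pi(\Lambda)$, $\mu\in\Gamma$, $u\in S^nV$, where $\lambda(\lambda+\rho)$ denotes the product in $S^2V$. *)

(* Defs.v *)
From HB Require Import structures.
From mathcomp Require Import all_boot all_order all_algebra.
From mathcomp Require Import finmap boolp classical_sets functions cardinality fsbigop.
From mathcomp Require Import reals complex ring.
From mathcomp.multinomials Require Import mpoly.

Set Implicit Arguments.
Unset Strict Implicit.
Unset Printing Implicit Defensive.

Import Order.TTheory GRing.Theory Num.Theory.

Local Open Scope classical_set_scope.
Local Open Scope complex_scope.
Local Open Scope ring_scope.

Notation plane R := 'rV[R[i]]_2.

Section Symplectic.
Variable R : realType.
Local Notation C := R[i].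
Implicit Types u v w : plane R.

Definition rho : plane R := const_mx 1.

Definition symp u v : C := u 0 0 * v 0 1 - u 0 1 * v 0 0.

Lemma sympE u v : symp u v = u 0 0 * v 0 1 - u 0 1 * v 0 0. Proof. by []. Qed.

Lemma sympDl u v w : symp (u + v) w = symp u w + symp v w.
Proof. by rewrite /symp !mxE; ring. Qed.

Lemma sympDr u v w : symp u (v + w) = symp u v + symp u w.
Proof. by rewrite /symp !mxE; ring. Qed.

Lemma sympC u v : symp u v = - symp v u.
Proof. by rewrite /symp; ring. Qed.

End Symplectic.
Arguments rho {R}.

(* [dsum G V] is the direct sum over [mu] in [G] of copies of [V], realized as
   the functions of finite support contained in [G]. The value at [mu] of an
   element is its coefficient on L_mu. *)
Section DirectSum.
Variable R : realType.
Local Notation C := R[i].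

Definition dsum_pred (G : set (plane R)) (V : lmodType C) :
    {pred (plane R -> V)} :=
  [pred f | `[< finite_set [set mu | f mu != 0] /\ [set mu | f mu != 0] `<=` G >]].
Arguments dsum_pred : clear implicits.

Lemma dsum_predP G (V : lmodType C) (f : plane R -> V) :
  reflect (finite_set [set mu | f mu != 0] /\ [set mu | f mu != 0] `<=` G)
          (f \in dsum_pred G V).
Proof. exact: asboolP. Qed.

Lemma dsum_submod_closed G (V : lmodType C) : submod_closed (dsum_pred G V).
Proof.
have sub0 : [set mu : plane R | (0 : plane R -> V) mu != 0] = set0.
  by apply/seteqP; split=> // mu /=; rewrite eqxx.
split=> [|a f g /dsum_predP [ff fG] /dsum_predP [gf gG]].
  by apply/dsum_predP; rewrite sub0; split.
have sub : [set mu | (a *: f + g) mu != 0] `<=`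
    [set mu | f mu != 0] `|` [set mu | g mu != 0].
  move=> mu /=; have [f0|] := eqVneq (f mu) 0; last by left.
  by rewrite !fctE /= f0 scaler0 add0r; right.
apply/dsum_predP; split; first by apply: sub_finite_set sub _; rewrite finite_setU.
by apply: subset_trans sub _; rewrite subUset.
Qed.

HB.instance Definition _ G (V : lmodType C) :=
  GRing.isSubmodClosed.Build C (plane R -> V) (dsum_pred G V)
    (dsum_submod_closed G V).

Record dsum (G : set (plane R)) (V : lmodType C) :=
  DSum { dval :> plane R -> V; dvalP : dval \in dsum_pred G V }.

HB.instance Definition _ G (V : lmodType C) := [isSub for @dval G V].
HB.instance Definition _ G (V : lmodType C) := [Choice of dsum G V by <:].
HB.instance Definition _ G (V : lmodType C) := [SubChoice_isSubLmodule of dsum G V by <:].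

Definition delta (V : lmodType C) (mu : plane R) (v : V) : plane R -> V :=
  fun nu => if nu == mu then v else 0.

Lemma delta_dsum G (V : lmodType C) mu (v : V) :
  G mu -> delta mu v \in dsum_pred G V.
Proof.
move=> Gmu; apply/dsum_predP.
have sub : [set nu | delta mu v nu != 0] `<=` [set mu].
  by move=> nu; rewrite /= /delta; have [//|_] := eqVneq nu mu; rewrite eqxx.
by split; [apply: sub_finite_set sub _ | move=> nu /sub ->].
Qed.

(* L_mu (x) v *)
Definition dsingle G (V : lmodType C) mu (Gmu : G mu) (v : V) : dsum G V :=
  DSum (delta_dsum v Gmu).

(* The bilinear extension of
   (L_la, L_mu (x) v) |-> L_(s la mu) (x) c la mu v. *)
Definition bext_fun (V V' : lmodType C) (s : plane R -> plane R -> plane R)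
    (c : plane R -> plane R -> {linear V -> V'})
    (x : plane R -> C^o) (f : plane R -> V) : plane R -> V' :=
  \sum_(la \in [set: plane R]) \sum_(mu \in [set: plane R])
    delta (s la mu) (x la *: c la mu (f mu)).

Lemma bext_closed G1 G2 G3 (V V' : lmodType C) s
    (c : plane R -> plane R -> {linear V -> V'})
    (x : dsum G1 C^o) (f : dsum G2 V) :
    (forall la mu, G1 la -> G2 mu -> G3 (s la mu)) ->
  bext_fun s c x f \in dsum_pred G3 V'.
Proof.
move=> sG; rewrite /bext_fun.
have [_ xG] := dsum_predP _ _ (dvalP x).
have [_ fG] := dsum_predP _ _ (dvalP f).
apply: rpred_sum => la _; apply: rpred_sum => mu _.
have delta0 nu : delta nu (0 : V') = 0.
  by apply/funext => k; rewrite /delta; case: ifP.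
have [x0|/xG Gla] := eqVneq (x la) 0; first by rewrite x0 scale0r delta0 rpred0.
have [f0|/fG Gmu] := eqVneq (f mu) 0.
  by rewrite f0 linear0 scaler0 delta0 rpred0.
exact/delta_dsum/sG.
Qed.

Definition bext G1 G2 G3 (V V' : lmodType C) s
    (sG : forall la mu, G1 la -> G2 mu -> G3 (s la mu))
    (c : plane R -> plane R -> {linear V -> V'})
    (x : dsum G1 C^o) (f : dsum G2 V) : dsum G3 V' :=
  DSum (bext_closed c x f sG).

Section Theory.
Variables (G1 : set (plane R)) (V : lmodType C).

Lemma dsumP (f g : dsum G1 V) : (forall mu, f mu = g mu) -> f = g.
Proof. by move=> fg; apply/val_inj/funext. Qed.

Lemma deltaP a mu (u v : V) :
  delta mu (a *: u + v) = a *: delta mu u + delta mu v.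
Proof.
by apply/funext => nu; rewrite /delta !fctE; case: eqP => //; rewrite scaler0 addr0.
Qed.

Lemma delta0 mu : delta mu (0 : V) = 0.
Proof. by apply/funext => k; rewrite /delta; case: ifP. Qed.

Lemma finsupp_sub (f : dsum G1 V) :
  exists A : {fset plane R}, forall mu, mu \notin A -> f mu = 0.
Proof.
have [/finite_fsetP [A fA] _] := dsum_predP _ _ (dvalP f).
exists A => mu; apply: contraNeq => f0.
by have : [set` A] mu by rewrite -fA.
Qed.

Lemma dsum_ind (P : dsum G1 V -> Prop) :
    P 0 -> (forall f g, P f -> P g -> P (f + g)) ->
    (forall mu (Gmu : G1 mu) v, P (dsingle Gmu v)) ->
  forall f, P f.
Proof.
move=> P0 PD Ps f; have [A fA] := finsupp_sub f.
pose t mu := if pselect (G1 mu) is left Gmu then dsingle Gmu (f mu) else 0.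
have -> : f = \sum_(mu <- A) t mu.
  apply: dsumP => nu.
  have -> : (\sum_(mu <- A) t mu : dsum G1 V) nu = \sum_(mu <- A) t mu nu.
    elim: (A : seq _) => [|mu r IH]; first by rewrite !big_nil.
    by rewrite !big_cons -IH.
  have tE mu : t mu nu = if nu == mu then f nu else 0.
    rewrite /t; case: pselect => [Gmu|Gmu] /=.
      by rewrite /delta; case: eqP => // ->.
    case: eqP => // Emu; apply/esym/eqP; apply: contrapT => /negP f0.
    have [_ fG] := dsum_predP _ _ (dvalP f).
    by apply: Gmu; rewrite -Emu; exact: fG.
  under eq_bigr do rewrite tE.
  have [nuA|/[dup] nuA /fA ->] := boolP (nu \in A).
    rewrite (big_fsetD1 nu) //= eqxx big1_fset ?addr0 // => mu.
    by rewrite !inE => /andP [/negPf]; rewrite eq_sym => ->.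
  by rewrite big1 // => mu _; case: ifP.
elim: (A : seq _) => [|mu r IH]; first by rewrite big_nil.
rewrite big_cons; apply: PD => //; rewrite /t; case: pselect => // Gmu.
Qed.

End Theory.

Section BilinearTheory.
Variables (G1 G2 G3 : set (plane R)) (V V' : lmodType C).
Variables (s : plane R -> plane R -> plane R).
Variables (c : plane R -> plane R -> {linear V -> V'}).

Lemma bext_funE (A B : {fset plane R}) (x : plane R -> C^o) (f : plane R -> V) :
    (forall mu, mu \notin A -> x mu = 0) ->
    (forall mu, mu \notin B -> f mu = 0) ->
  bext_fun s c x f =
  \sum_(la <- A) \sum_(mu <- B) delta (s la mu) (x la *: c la mu (f mu)).
Proof.
move=> xA fB; rewrite /bext_fun.
have inner la : \sum_(mu \in [set: plane R])
    delta (s la mu) (x la *: c la mu (f mu)) =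
    \sum_(mu <- B) delta (s la mu) (x la *: c la mu (f mu)).
  apply: fsbigTE => mu /fB ->; rewrite linear0 scaler0.
  by apply/funext => k; rewrite /delta; case: ifP.
under eq_fsbigr do rewrite inner.
apply: fsbigTE => la /xA ->; apply: big1 => mu _; rewrite scale0r.
by apply/funext => k; rewrite /delta; case: ifP.
Qed.

Hypothesis sG : forall la mu, G1 la -> G2 mu -> G3 (s la mu).

Lemma bext_linearl (f : dsum G2 V) :
  linear (fun x : dsum G1 C^o => bext sG c x f).
Proof.
move=> a x y; apply/val_inj => /=.
have [A xA] := finsupp_sub x; have [B yB] := finsupp_sub y.
have [D fD] := finsupp_sub f.
have xAB la : la \notin (A `|` B)%fset -> x la = 0.
  by rewrite inE negb_or => /andP [/xA].
have yAB la : la \notin (A `|` B)%fset -> y la = 0.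
  by rewrite inE negb_or => /andP [_ /yB].
rewrite (bext_funE xAB fD) (bext_funE yAB fD).
rewrite (@bext_funE (A `|` B)%fset D _ _ _ fD); last first.
  by move=> la nla /=; rewrite !fctE xAB // yAB // scaler0 addr0.
rewrite scaler_sumr -big_split /=; apply: eq_bigr => la _.
rewrite scaler_sumr -big_split /=; apply: eq_bigr => mu _.
by rewrite -deltaP scalerDl scalerA.
Qed.

Lemma bext_linearr (x : dsum G1 C^o) :
  linear (fun f : dsum G2 V => bext sG c x f).
Proof.
move=> a f g; apply/val_inj => /=.
have [A fA] := finsupp_sub f; have [B gB] := finsupp_sub g.
have [D xD] := finsupp_sub x.
have fAB la : la \notin (A `|` B)%fset -> f la = 0.
  by rewrite inE negb_or => /andP [/fA].
have gAB la : la \notin (A `|` B)%fset -> g la = 0.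
  by rewrite inE negb_or => /andP [_ /gB].
rewrite (bext_funE xD fAB) (bext_funE xD gAB).
rewrite (@bext_funE D (A `|` B)%fset _ _ xD); last first.
  by move=> la nla /=; rewrite !fctE fAB // gAB // scaler0 addr0.
rewrite scaler_sumr -big_split /=; apply: eq_bigr => la _.
rewrite scaler_sumr -big_split /=; apply: eq_bigr => mu _.
by rewrite -deltaP !fctE linearP scalerDr !scalerA mulrC.
Qed.

Lemma bext_single la (Gla : G1 la) mu (Gmu : G2 mu) (a : C^o) (v : V) :
  bext sG c (dsingle Gla a) (dsingle Gmu v) =
  dsingle (sG Gla Gmu) (a *: c la mu v).
Proof.
apply/val_inj => /=.
rewrite (@bext_funE [fset la]%fset [fset mu]%fset).
- by rewrite !big_seq_fset1 /delta !eqxx.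
- by move=> nu; rewrite inE /delta => /negPf ->.
- by move=> nu; rewrite inE /delta => /negPf ->.
Qed.

End BilinearTheory.
End DirectSum.

(* The symmetric algebra of the plane V is the polynomial ring in two
   variables; S^n V is the space [dhomog 2 _ n] of homogeneous polynomials of
   degree n. *)
Section RingIdentities.
Variable K : comNzRingType.

Lemma jacobi_id (p0 p1 q0 q1 r0 r1 p00 p01 p11 q00 q01 q11 r00 r01 r11 : K) :
  (p00 * q1 + p0 * q01 - (p01 * q0 + p1 * q00)) * r1 -
  (p01 * q1 + p0 * q11 - (p11 * q0 + p1 * q01)) * r0 =
  p0 * (q01 * r1 + q0 * r11 - (q11 * r0 + q1 * r01)) -
  p1 * (q00 * r1 + q0 * r01 - (q01 * r0 + q1 * r00)) -
  (q0 * (p01 * r1 + p0 * r11 - (p11 * r0 + p1 * r01)) -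
   q1 * (p00 * r1 + p0 * r01 - (p01 * r0 + p1 * r00))).
Proof. by ring. Qed.

Section Derivations.
Variables D E : K -> K.
Hypothesis DB : forall p q, D (p - q) = D p - D q.
Hypothesis EB : forall p q, E (p - q) = E p - E q.
Hypothesis DM : forall p q, D (p * q) = D p * q + p * D q.
Hypothesis EM : forall p q, E (p * q) = E p * q + p * E q.
Hypothesis EDC : forall p, E (D p) = D (E p).
Let br p q := D p * E q - E p * D q.

Lemma derivation_leibniz p q r : br p (q * r) = br p q * r + q * br p r.
Proof. by rewrite /br DM EM; ring. Qed.

Lemma derivation_jacobi p q r :
  br (br p q) r = br p (br q r) - br q (br p r).
Proof. by rewrite /br !(DB, EB) !(DM, EM) !EDC; exact: jacobi_id. Qed.

End Derivations.

Lemma combine_id (h d t t' S1 S2 r w u B D E F : K) :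
    h * d = 1 -> t * S2 - t' * S1 = r * w ->
  (t + S1) * (S2 * u + h * D) +
  h * (S2 * B + h * (d * r * E - d * t * D + d * t' * B + F)) -
  ((t' + S2) * (S1 * u + h * B) + h * (S1 * D + h * F)) =
  r * (w * u + h * E).
Proof.
move=> hd rw; rewrite [r * (_ + _)]mulrDr [r * (w * u)]mulrA -rw.
have E1 z : h * (h * (d * z)) = h * z by rewrite [h * (d * z)]mulrA hd mul1r.
have -> : h * (S2 * B + h * (d * r * E - d * t * D + d * t' * B + F)) =
  h * (S2 * B) + h * (h * (d * (r * E))) - h * (h * (d * (t * D))) +
  h * (h * (d * (t' * B))) + h * (h * F) by ring.
by rewrite !E1; ring.
Qed.

Lemma quad_id (a0 a1 b0 b1 x y : K) :
  let la := a0 * x + a1 * y in let mu := b0 * x + b1 * y in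
  let lar := (a0 + 1) * x + (a1 + 1) * y in
  let mur := (b0 + 1) * x + (b1 + 1) * y in
  let lm := (a0 + b0) * x + (a1 + b1) * y in
  let lmr := (a0 + b0 + 1) * x + (a1 + b1 + 1) * y in
  (a0 * lar + la * (a0 + 1)) * (b1 * mur + mu * (b1 + 1)) -
  (a1 * lar + la * (a1 + 1)) * (b0 * mur + mu * (b0 + 1)) =
  2 * ((a0 + 1) * (b1 + 1) - (a1 + 1) * (b0 + 1)) * (lm * lmr)
  - 2 * ((a0 + 1) * b1 - (a1 + 1) * b0) * (mu * mur)
  + 2 * ((b0 + 1) * a1 - (b1 + 1) * a0) * (la * lar).
Proof. by rewrite /=; ring. Qed.

End RingIdentities.

Section SymmetricAlgebra.
Variable R : realType.
Local Notation C := R[i].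
Local Notation SV := {mpoly C[2]}.
Implicit Types p q r : SV.

Definition linform (v : plane R) : SV := v 0 0 *: 'X_0 + v 0 1 *: 'X_1.

Definition poisson p q : SV :=
  mderiv 0 p * mderiv 1 q - mderiv 1 p * mderiv 0 q.

Lemma mderiv_linform (i : 'I_2) v : mderiv i (linform v) = (v 0 i)%:MP.
Proof.
rewrite /linform mderivD !mderivZ !mderivX !mnm1E.
have [->|->] : i = 0 \/ i = 1.
  by case: i => [[|[|//]] lti]; [left | right]; apply/val_inj.
- rewrite eqxx (_ : (1 == 0 :> 'I_2) = false) // scale0r scaler0 addr0 scale1r.
  by rewrite -[X in (X - _)%MM]add0m addmK mpolyX0 -mul_mpolyC mulr1.
- rewrite eqxx (_ : (0 == 1 :> 'I_2) = false) // scale0r scaler0 add0r scale1r.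
  by rewrite -[X in (X - _)%MM]add0m addmK mpolyX0 -mul_mpolyC mulr1.
Qed.

Lemma poisson_linform u v : poisson (linform u) (linform v) = (symp u v)%:MP.
Proof. by rewrite /poisson !mderiv_linform /symp mpolyCB !mpolyCM. Qed.

Lemma poissonC p q : poisson p q = - poisson q p.
Proof. by rewrite /poisson opprB mulrC [mderiv 1 p * _]mulrC. Qed.

Lemma poissonDr p q r : poisson p (q + r) = poisson p q + poisson p r.
Proof. by rewrite /poisson !mderivD !mulrDr opprD addrACA. Qed.

Lemma poissonZr p (a : C) q : poisson p (a *: q) = a *: poisson p q.
Proof. by rewrite /poisson !mderivZ -!scalerAr -scalerBr. Qed.

Lemma poissonDl p q r : poisson (p + q) r = poisson p r + poisson q r.
Proof. by rewrite ![poisson _ r]poissonC poissonDr opprD. Qed.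

Lemma poissonZl (a : C) p q : poisson (a *: p) q = a *: poisson p q.
Proof. by rewrite ![poisson _ q]poissonC poissonZr scalerN. Qed.

Lemma poissonBl p q r : poisson (p - q) r = poisson p r - poisson q r.
Proof. by rewrite -scaleN1r poissonDl poissonZl scaleN1r. Qed.

Lemma poissonMr p q r : poisson p (q * r) = poisson p q * r + q * poisson p r.
Proof. exact: (derivation_leibniz (mderivM 0) (mderivM 1)). Qed.

Lemma poisson_jacobi p q r :
  poisson (poisson p q) r = poisson p (poisson q r) - poisson q (poisson p r).
Proof.
exact: (derivation_jacobi (mderivB 0) (mderivB 1) (mderivM 0) (mderivM 1)
  (mderiv_comm 0 1)).
Qed.

Lemma mderiv_homog n (i : 'I_2) p :
  p \is n.+1.-homog -> mderiv i p \is n.-homog.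
Proof.
move=> /dhomogP hp; apply/dhomogP => m.
rewrite mcoeff_msupp mcoeff_mderiv => nz.
have : p@_(m + U_(i)) != 0 by apply: contraNneq nz => ->; rewrite mul0rn.
by rewrite -mcoeff_msupp => /hp /=; rewrite mdegD mdeg1 addn1 => -[].
Qed.

Lemma mderiv_homog0 (i : 'I_2) p : p \is 0.-homog -> mderiv i p = 0.
Proof.
move=> hp; apply/mpolyP => m; rewrite mcoeff0 mcoeff_mderiv.
rewrite (dhomog_nemf_coeff hp) ?mul0rn //=.
by rewrite mdegD mdeg1 addn1.
Qed.

Lemma poisson_homog n p q :
  p \is 2.-homog -> q \is n.-homog -> poisson p q \is n.-homog.
Proof.
move=> hp; case: n => [|n] hq.
  by rewrite /poisson !(mderiv_homog0 _ hq) !mulr0 subrr rpred0.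
rewrite /poisson rpredB //; rewrite -[n.+1]add1n; apply: dhomogM;
  exact: mderiv_homog.
Qed.

Lemma linform_homog v : linform v \is 1.-homog.
Proof. by rewrite rpredD // rpredZ // dhomogX /= mdeg1. Qed.

(* la (la + rho) in S^2 V *)
Definition quad (la : plane R) : SV := linform la * linform (la + rho).

Lemma quad_homog la : quad la \is 2.-homog.
Proof. by apply: (@dhomogM _ _ _ 1 _ 1); exact: linform_homog. Qed.

Lemma poisson_quad la mu :
  poisson (quad la) (quad mu) =
  (2 * symp (la + rho) (mu + rho)) *: quad (la + mu)
  - (2 * symp (la + rho) mu) *: quad mu
  + (2 * symp (mu + rho) la) *: quad la.
Proof.
rewrite /poisson /quad !mderivM !mderiv_linform /linform /symp !mxE.
rewrite -!mul_mpolyC !(mpolyCM, mpolyCD, mpolyCN, mpolyC1).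
exact: quad_id.
Qed.

Definition quad_act n (la : plane R) (u : dhomog 2 C n) : dhomog 2 C n :=
  DHomog (poisson_homog (quad_homog la) (dhomog_is_dhomog u)).

Lemma quad_act_linear n la : linear (@quad_act n la).
Proof.
by move=> a u v; apply/val_inj; rewrite /= poissonDr poissonZr.
Qed.

HB.instance Definition _ n la :=
  GRing.isLinear.Build C (dhomog 2 C n) (dhomog 2 C n) _ (quad_act la)
    (@quad_act_linear n la).

Lemma quad_actD n la (u v : dhomog 2 C n) :
  quad_act la (u + v) = quad_act la u + quad_act la v.
Proof. exact: (raddfD (quad_act la)). Qed.

Lemma quad_actZ n la (a : C) (u : dhomog 2 C n) :
  quad_act la (a *: u) = a *: quad_act la u.
Proof. exact: (linearZZ (quad_act la)). Qed.

End SymmetricAlgebra.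

Section AVModules.
Variables (R : realType) (N : nat).
Local Notation C := R[i].
Variable pi : {additive 'rV[int]_N -> plane R}.
Implicit Types (la mu nu : plane R).

Definition in_lattice : set (plane R) := [set pi x | x in [set: 'rV[int]_N]].

(* The cosets of pi(Lambda) are the sets [coset ga]. *)
Definition coset (ga : plane R) : set (plane R) :=
  [set mu | in_lattice (mu - ga)].

Lemma in_latticeD la mu : in_lattice la -> in_lattice mu -> in_lattice (la + mu).
Proof. by move=> [x _ <-] [y _ <-]; exists (x + y); rewrite // raddfD. Qed.

Lemma in_lattice_pi x : in_lattice (pi x). Proof. by exists x. Qed.

Lemma coset_shift x : coset (- rho) (pi x - rho).
Proof. by rewrite /coset /= opprK subrK; exact: in_lattice_pi. Qed.

Lemma coset_W ga la mu : in_lattice la -> coset ga mu -> coset ga (la + mu).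
Proof. by rewrite /coset /= -addrA; exact: in_latticeD. Qed.

Lemma coset_A ga la mu :
  coset (- rho) la -> coset ga mu -> coset ga (la + mu + rho).
Proof.
rewrite /coset /= opprK => Hla Hmu.
by rewrite [la + mu + rho]addrAC -[_ - ga]addrA; exact: in_latticeD.
Qed.

(* S is the Poisson algebra with basis (L_la) for la in C^2, product
   L_la . L_mu = L_(la + mu + rho) and bracket
   {L_la, L_mu} = <la + rho, mu + rho> L_(la + mu). [Wpi] and [Api] are the
   subspaces of S spanned by the L_la with la in pi(Lambda), and by the
   L_(la - rho) with la in pi(Lambda). *)
Definition Wpi := dsum in_lattice C^o.
Definition Api := dsum (coset (- rho)) C^o.

Definition LW (x : 'rV[int]_N) : Wpi := dsingle (in_lattice_pi x) 1.
Definition LA (x : 'rV[int]_N) : Api := dsingle (coset_shift x) 1.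

Definition br_coef la mu : {linear C^o -> C^o} :=
  *:%R (symp (la + rho) (mu + rho)).

(* The bracket of S, on W_pi x W_pi and on W_pi x A_pi. *)
Definition brW : Wpi -> Wpi -> Wpi := bext in_latticeD br_coef.
Definition brWA : Wpi -> Api -> Api := bext (@coset_W (- rho)) br_coef.

(* The product of S, on A_pi. *)
Definition mulA : Api -> Api -> Api :=
  bext (@coset_A (- rho)) (fun _ _ => idfun : {linear C^o -> C^o}).

(* [LA 0] is the unit L_(- rho) of A_pi. The actions of A_pi and W_pi are bilinear on the whole algebras; [actVA] is
   stated on the bases L_la and L_(mu - rho). *)
Record avModule := AVModule {
  av_sort :> lmodType C;
  actA : Api -> av_sort -> av_sort;
  actV : Wpi -> av_sort -> av_sort;
  actA_linearl : forall v, linear (actA^~ v);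
  actA_linearr : forall a, linear (actA a);
  actV_linearl : forall v, linear (actV^~ v);
  actV_linearr : forall x, linear (actV x);
  actA1 : forall v, actA (LA 0) v = v;
  actAM : forall a b v, actA (mulA a b) v = actA a (actA b v);
  actVbr : forall x y v,
    actV (brW x y) v = actV x (actV y v) - actV y (actV x v);
  actVA : forall (x y : 'rV[int]_N) v,
    actV (LW x) (actA (LA y) v) =
    actA (brWA (LW x) (LA y)) v + actA (LA y) (actV (LW x) v)
}.

Section Properties.
Variable T : avModule.

Definition weight_space mu : set T :=
  [set v | actV (LW 0) v = symp rho mu *: v].

(* T is the direct sum of the T_mu for mu in the coset of ga. *)
Definition graded_by ga : Prop :=
  forall v : T, exists! f : plane R -> T,
    [/\ finite_set [set mu | f mu != 0],
        [set mu | f mu != 0] `<=` coset ga,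
        forall mu, weight_space mu (f mu) &
        v = \sum_(mu \in [set: plane R]) f mu].

Definition finite_rank ga : Prop :=
  forall mu, coset ga mu ->
  exists (k : nat) (e : 'I_k -> T),
    (forall i, weight_space mu (e i)) /\
    (forall v, weight_space mu v ->
       exists c : 'I_k -> C, v = \sum_(i < k) c i *: e i).

Definition av_submodule (U : set T) : Prop :=
  [/\ U 0,
      forall (a : C) u v, U u -> U v -> U (a *: u + v),
      forall a u, U u -> U (actA a u) &
      forall x u, U u -> U (actV x u)].

Definition av_simple : Prop :=
  (exists v : T, v != 0) /\
  (forall U, av_submodule U -> U = [set 0] \/ U = setT).

End Properties.

Definition av_iso (T T' : avModule) : Prop :=
  exists phi : {linear T -> T'},
    [/\ bijective phi,
        forall a v, phi (actA a v) = actA a (phi v) &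
        forall x v, phi (actV x v) = actV x (phi v)].

Lemma dsingle_eq G (V : lmodType C) la mu (Gla : G la) (Gmu : G mu) (v w : V) :
  la = mu -> v = w -> dsingle Gla v = dsingle Gmu w.
Proof. by move=> E Ev; apply/val_inj; rewrite /= E Ev. Qed.

Lemma dsingleZ G (V : lmodType C) mu (Gmu : G mu) (a : C) (v : V) :
  a *: dsingle Gmu v = dsingle Gmu (a *: v).
Proof.
by apply: dsumP => nu; rewrite /= !fctE /delta; case: ifP => // _; rewrite scaler0.
Qed.

Lemma dsingleD G (V : lmodType C) mu (Gmu : G mu) (v w : V) :
  dsingle Gmu v + dsingle Gmu w = dsingle Gmu (v + w).
Proof.
by apply: dsumP => nu; rewrite /= !fctE /delta; case: ifP => // _; rewrite addr0.
Qed.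

Section TensorModule.
Variables (n : nat) (ga : plane R).
Local Notation SnV := (dhomog 2 C n).

(* [f mu] is the coefficient u of L_mu (x) u. *)
Definition M_sort := dsum (coset ga) SnV.

Definition M_coef la mu (u : SnV) : SnV :=
  symp (la + rho) (mu + rho) *: u + 2^-1 *: quad_act la u.

Lemma M_coef_linear la mu : linear (M_coef la mu).
Proof.
move=> a u v; rewrite /M_coef [quad_act la _]linearP !scalerDr !scalerA.
by rewrite ![_ * a]mulrC addrACA.
Qed.

HB.instance Definition _ la mu :=
  GRing.isLinear.Build C SnV SnV _ (M_coef la mu) (M_coef_linear la mu).

Lemma M_coefZ la mu a (u : SnV) : M_coef la mu (a *: u) = a *: M_coef la mu u.
Proof. exact: (linearZZ (M_coef la mu)). Qed.

Definition M_actV : Wpi -> M_sort -> M_sort :=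
  bext (@coset_W ga) (fun la mu => M_coef la mu : {linear SnV -> SnV}).

Definition M_actA : Api -> M_sort -> M_sort :=
  bext (@coset_A ga) (fun _ _ => idfun : {linear SnV -> SnV}).

Lemma linear_0 (U V : lmodType C) (f : U -> V) : linear f -> f 0 = 0.
Proof.
move=> fL; have := fL 1 0 0; rewrite !scale1r addr0.
by move/eqP; rewrite -subr_eq subrr => /eqP.
Qed.

Lemma linear_D (U V : lmodType C) (f : U -> V) u v :
  linear f -> f (u + v) = f u + f v.
Proof. by move=> fL; have := fL 1 u v; rewrite !scale1r. Qed.

Lemma M_actA1 f : M_actA (LA 0) f = f.
Proof.
elim/dsum_ind: f => [|f g IHf IHg|mu Gmu v].
- exact: (linear_0 (bext_linearr _ _ _)).
- by rewrite /M_actA (linear_D _ _ (bext_linearr _ _ _)) -/M_actA IHf IHg.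
- rewrite /M_actA bext_single; apply: dsingle_eq; last by rewrite scale1r.
  by rewrite raddf0 sub0r addrAC addNr add0r.
Qed.

Lemma M_actAM a b f : M_actA (mulA a b) f = M_actA a (M_actA b f).
Proof.
have Al := @bext_linearl; have Ar := @bext_linearr.
elim/dsum_ind: a => [|a a' IHa IHa'|la Gla a].
- by rewrite /M_actA /mulA !(linear_0 (Al _ _ _ _ _ _ _ _ _ _)).
- rewrite /M_actA /mulA !(linear_D _ _ (Al _ _ _ _ _ _ _ _ _ _)).
  by rewrite -/mulA -/M_actA IHa IHa'.
elim/dsum_ind: b => [|b b' IHb IHb'|mu Gmu b].
- rewrite /M_actA /mulA (linear_0 (Ar _ _ _ _ _ _ _ _ _ _)).
  by rewrite !(linear_0 (Al _ _ _ _ _ _ _ _ _ _)) (linear_0 (Ar _ _ _ _ _ _ _ _ _ _)).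
- rewrite /M_actA /mulA (linear_D _ _ (Ar _ _ _ _ _ _ _ _ _ _)).
  rewrite !(linear_D _ _ (Al _ _ _ _ _ _ _ _ _ _)) (linear_D _ _ (Ar _ _ _ _ _ _ _ _ _ _)).
  by rewrite -/mulA -/M_actA IHb IHb'.
elim/dsum_ind: f => [|f g IHf IHg|nu Gnu v].
- by rewrite /M_actA !(linear_0 (Ar _ _ _ _ _ _ _ _ _ _)).
- rewrite /M_actA !(linear_D _ _ (Ar _ _ _ _ _ _ _ _ _ _)).
  by rewrite -/M_actA IHf IHg.
rewrite /M_actA /mulA !bext_single; apply: dsingle_eq => /=.
  by rewrite -!addrA; congr (_ + (_ + _)); rewrite addrCA.
by rewrite scalerA.
Qed.

Lemma quad_act_br la mu (u : SnV) :
  quad_act la (quad_act mu u) - quad_act mu (quad_act la u) =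
  (2 * symp (la + rho) (mu + rho)) *: quad_act (la + mu) u
  - (2 * symp (la + rho) mu) *: quad_act mu u
  + (2 * symp (mu + rho) la) *: quad_act la u.
Proof.
apply/val_inj; rewrite /= -poisson_jacobi poisson_quad.
rewrite (poissonDl (_ - _)).
rewrite (poissonBl (_ *: _)).
by congr (_ - _ + _); exact: poissonZl.
Qed.

Lemma M_coef_combine (h t t' S1 S2 r w : C) (u B D E F G : SnV) :
    h * 2 = 1 -> t * S2 - t' * S1 = r * w ->
    G - F = (2 * r) *: E - (2 * t) *: D + (2 * t') *: B ->
  (t + S1) *: (S2 *: u + h *: D) + h *: (S2 *: B + h *: G) -
  ((t' + S2) *: (S1 *: u + h *: B) + h *: (S1 *: D + h *: F)) =
  r *: (w *: u + h *: E).
Proof.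
move=> h2 rw /eqP; rewrite subr_eq => /eqP ->.
apply/val_inj; rewrite /= -!mul_mpolyC !mpolyCM.
have h2P : h%:MP * 2%:MP = 1 :> {mpoly C[2]} by rewrite -mpolyCM h2.
have rwP : t%:MP * S2%:MP - t'%:MP * S1%:MP = r%:MP * w%:MP :> {mpoly C[2]}.
  by rewrite -!mpolyCM -mpolyCB rw.
rewrite (@mpolyCD 2 C t S1) (@mpolyCD 2 C t' S2); exact: combine_id h2P rwP.
Qed.

Lemma M_coef_br la mu nu (u : SnV) :
  M_coef la (mu + nu) (M_coef mu nu u) - M_coef mu (la + nu) (M_coef la nu u) =
  symp (la + rho) (mu + rho) *: M_coef (la + mu) nu u.
Proof.
have symp_split (a b c : plane R) :
    symp (a + rho) (b + c + rho) = symp (a + rho) b + symp (a + rho) (c + rho).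
  by rewrite -(addrA b c) (sympDr _ b).
have quadE := quad_act_br la mu u.
rewrite /M_coef !quad_actD !quad_actZ !symp_split.
apply: M_coef_combine quadE; first by rewrite mulVf ?pnatr_eq0.
by rewrite /symp !mxE; ring.
Qed.

Lemma M_actVbr x y f :
  M_actV (brW x y) f = M_actV x (M_actV y f) - M_actV y (M_actV x f).
Proof.
have Al := @bext_linearl; have Ar := @bext_linearr.
elim/dsum_ind: x => [|x x' IHx IHx'|la Gla a].
- rewrite /M_actV /brW !(linear_0 (Al _ _ _ _ _ _ _ _ _ _)).
  by rewrite (linear_0 (Ar _ _ _ _ _ _ _ _ _ _)) subrr.
- rewrite /M_actV /brW !(linear_D _ _ (Al _ _ _ _ _ _ _ _ _ _)).
  rewrite (linear_D _ _ (Ar _ _ _ _ _ _ _ _ _ _)).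
  by rewrite -/brW -/M_actV IHx IHx' opprD addrACA.
elim/dsum_ind: y => [|y y' IHy IHy'|mu Gmu b].
- rewrite /M_actV /brW (linear_0 (Ar _ _ _ _ _ _ _ _ _ _)).
  by rewrite !(linear_0 (Al _ _ _ _ _ _ _ _ _ _)) (linear_0 (Ar _ _ _ _ _ _ _ _ _ _)) subrr.
- rewrite /M_actV /brW (linear_D _ _ (Ar _ _ _ _ _ _ _ _ _ _)).
  rewrite !(linear_D _ _ (Al _ _ _ _ _ _ _ _ _ _)) (linear_D _ _ (Ar _ _ _ _ _ _ _ _ _ _)).
  by rewrite -/brW -/M_actV IHy IHy' opprD addrACA.
elim/dsum_ind: f => [|f g IHf IHg|nu Gnu v].
- by rewrite /M_actV !(linear_0 (Ar _ _ _ _ _ _ _ _ _ _)) subrr.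
- rewrite /M_actV !(linear_D _ _ (Ar _ _ _ _ _ _ _ _ _ _)).
  by rewrite -/M_actV IHf IHg opprD addrACA.
rewrite /M_actV /brW !bext_single /=.
have E1 : mu + (la + nu) = la + mu + nu by rewrite addrCA addrA.
have E2 : la + (mu + nu) = la + mu + nu by rewrite addrA.
apply: dsumP => k; rewrite /= !fctE /= /delta E1 E2.
case: ifP => _; last by rewrite subr0.
rewrite !M_coefZ (scalerA a b) (scalerA b a) [b * a]mulrC -scalerBr M_coef_br.
by rewrite !scalerA; congr (_ *: _); exact: mulrAC.
Qed.

Lemma M_actVA (x y : 'rV[int]_N) f :
  M_actV (LW x) (M_actA (LA y) f) =
  M_actA (brWA (LW x) (LA y)) f + M_actA (LA y) (M_actV (LW x) f).
Proof.
have Al := @bext_linearl; have Ar := @bext_linearr.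
elim/dsum_ind: f => [|f g IHf IHg|nu Gnu v].
- by rewrite /M_actV /M_actA !(linear_0 (Ar _ _ _ _ _ _ _ _ _ _)) addr0.
- rewrite /M_actV /M_actA !(linear_D _ _ (Ar _ _ _ _ _ _ _ _ _ _)).
  by rewrite -/M_actV -/M_actA IHf IHg addrACA.
rewrite /M_actV /M_actA /brWA !bext_single /=.
apply: dsumP => k; rewrite /= !fctE /= /delta.
have -> : pi x + (pi y - rho + nu + rho) = pi x + pi y + nu.
  by rewrite addrAC subrK addrA.
have -> : pi x + (pi y - rho) + nu + rho = pi x + pi y + nu.
  by rewrite !addrA [_ + nu + rho]addrAC subrK.
have -> : pi y - rho + (pi x + nu) + rho = pi x + pi y + nu.
  by rewrite addrAC subrK addrCA addrA.
case: ifP => _; last by rewrite addr0.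
rewrite !scale1r (_ : pi y - rho + nu + rho = pi y + nu); last first.
  by rewrite addrAC subrK.
have -> : M_coef (pi x) (pi y + nu) v =
    symp (pi x + rho) (pi y) *: v + M_coef (pi x) nu v.
  by rewrite /M_coef -(addrA (pi y)) (sympDr _ (pi y)) scalerDl addrA.
by rewrite (subrK rho (pi y)) (_ : _%:A = symp (pi x + rho) (pi y)) //; exact: mulr1.
Qed.

(* The AV_pi-module M^n(ga + pi(Lambda)). *)
Definition Mmod : avModule :=
  @AVModule M_sort M_actA M_actV
    (fun f => bext_linearl _ _ f) (fun a => bext_linearr _ _ a)
    (fun f => bext_linearl _ _ f) (fun x => bext_linearr _ _ x)
    M_actA1 M_actAM M_actVbr M_actVA.

End TensorModule.

End AVModules.

(* Main.v *)
Require Import Defs.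
From HB Require Import structures.
From mathcomp Require Import all_boot all_order all_algebra.
From mathcomp Require Import finmap boolp classical_sets functions cardinality fsbigop.
From mathcomp Require Import reals complex ring.
From mathcomp.multinomials Require Import mpoly.

Set Implicit Arguments.
Unset Strict Implicit.
Unset Printing Implicit Defensive.

Import Order.TTheory GRing.Theory Num.Theory.

Local Open Scope classical_set_scope.
Local Open Scope complex_scope.
Local Open Scope ring_scope.

(** Multiplication by the invertible elements [LA x] identifies all weight spaces
    of [T] with a single one, the fibre, which has finite dimension. The action
    of [LW x] on the fibre, followed by the translation back to the fibre, is an
    endomorphism [E x] of the fibre, and the module structure of [T] amounts to
    the relation
      [E x, E y] = <x + rho, y + rho> E (x + y) - <x + rho, y> E y
                   + <y + rho, x> E x,
    where [x] stands for [pi x]. This is the commutation relation of the vector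
    fields [(e^x - 1) d_(x + rho)] of the plane, which vanish at the origin. If
    [T] is simple, then the family [E] is irreducible ([fibre_irreducible]).

    The family [E] is polynomial in [x]. Indeed, on the line [Z b] the [k]-th
    difference of [E] at [- b] corresponds to a vector field with a zero of
    order [k]. It is an eigenvector of the commutator with [E (- b)], for an
    eigenvalue proportional to [k - 1], and in finite dimension this forces it
    to vanish for large [k] ([iter_dif_opp_eq0]). The relation between
    [E (j b)], now polynomial in [j], and [E z] makes [E] polynomial along every
    line of direction [b], thanks to [<z + 2 rho, b> <> 0] ([iter_dif_eq0]).

    The degree of [E] is at most two. The leading form of a polynomial family of
    degree at least three consists of commuting nilpotent matrices that span an
    ideal; their common kernel is nonzero and stable, hence is the whole
    fibre ([difs_vanish_pred]). So [E x = E 0 + L x + B x x], with [L] additive and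
    [B] biadditive and symmetric.

    These forms extend to [C^N]. On the kernel of the map from [C^N] to the plane
    they span nilpotent ideals, and vanish for the same reason as above. Thus [B]
    lives on the plane, where the relation turns it into a representation of
    [S^2 V = sl2]. The matrices [L x - B x rho] commute with the whole family, so
    they are scalars by Schur's lemma, and the representation of sl2 is
    irreducible ([reduction_to_sl2]): it is some [S^m V] ([sl2_irreducible_sym]).
    The scalars form the value at [x + rho] of a linear form [<_, c>], and the
    fibre with its endomorphisms is that of [M^m (c - rho)]. Translating it back
    to all weights gives the isomorphism ([av_iso_of_fibre]). *)


(** * Commutators of matrices *)

(** The commutator is locked to keep it an atom of the entrywise computations
    made by the tactic [mx_ring]. *)
HB.lock Definition br (K : pzRingType) n (A B : 'M[K]_n) : 'M[K]_n :=
  A *m B - B *m A.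

Section Commutator.
Variables (C : comNzRingType) (n : nat).
Implicit Types A B : 'M[C]_n.+1.

Lemma brE A B : br A B = A * B - B * A. Proof. by rewrite unlock. Qed.

Lemma brC A B : br A B = - br B A.
Proof. by rewrite !brE opprB. Qed.

Lemma brDr A B B' : br A (B + B') = br A B + br A B'.
Proof. by rewrite !brE mulrDr mulrDl opprD addrACA. Qed.

Lemma brZr c A B : br A (c *: B) = c *: br A B.
Proof. by rewrite !brE -scalerAr -scalerAl scalerBr. Qed.

Lemma brDl A A' B : br (A + A') B = br A B + br A' B.
Proof. by rewrite brC brDr opprD -!(brC _ B). Qed.

Lemma brZl c A B : br (c *: A) B = c *: br A B.
Proof. by rewrite brC brZr -scalerN -brC. Qed.

Lemma brNr A B : br A (- B) = - br A B.
Proof. by rewrite -scaleN1r brZr scaleN1r. Qed.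

Lemma brNl A B : br (- A) B = - br A B.
Proof. by rewrite -scaleN1r brZl scaleN1r. Qed.

Lemma brBr A B B' : br A (B - B') = br A B - br A B'.
Proof. by rewrite brDr brNr. Qed.

Lemma brBl A A' B : br (A - A') B = br A B - br A' B.
Proof. by rewrite brDl brNl. Qed.

Lemma br0r A : br A 0 = 0. Proof. by rewrite brE mulr0 mul0r subrr. Qed.

Lemma brAA A : br A A = 0. Proof. by rewrite brE subrr. Qed.

Lemma br_scalarl c A : br c%:M A = 0.
Proof. by rewrite unlock mul_scalar_mx mul_mx_scalar subrr. Qed.

Lemma br_scalarr c A : br A c%:M = 0.
Proof. by rewrite brC br_scalarl oppr0. Qed.

Lemma br_mulmx A B (v : 'cV[C]_n.+1) :
  A *m (B *m v) = B *m (A *m v) + br A B *m v.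
Proof. by rewrite unlock mulmxBl -!mulmxA addrC subrK. Qed.

Lemma brX A B c k : br A B = c *: B -> br A (B ^+ k) = (k%:R * c) *: B ^+ k.
Proof.
rewrite !brE => AB; elim: k => [|k IH].
  by rewrite expr0 mul0r scale0r mulr1 mul1r subrr.
have -> : A * B ^+ k.+1 - B ^+ k.+1 * A =
    (A * B - B * A) * B ^+ k + B * (A * B ^+ k - B ^+ k * A).
  by rewrite mulrBl mulrBr exprS !mulrA addrA subrK.
rewrite AB IH -scalerAl -scalerAr -exprS -scalerDl; congr (_ *: _).
by rewrite -[in RHS]natr1 mulrDl mul1r addrC.
Qed.

End Commutator.

Section NilpotentMatrices.
Variables (C : numClosedFieldType) (n : nat).
Implicit Types A B : 'M[C]_n.+1.

(** The multiples [k c] are infinitely many, and the operator [br A] on the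
    finite-dimensional space of matrices has finitely many eigenvalues. *)
Lemma ad_eigenvalue_bound A (c : C) : c != 0 ->
  exists k0, forall k B, (k0 <= k)%N -> br A B = (k%:R * c) *: B -> B = 0.
Proof.
move=> c0.
(* the matrix of [br A], acting on vectorized matrices *)
pose ad := lin_mx (mulmx A) - lin_mx (mulmxr A).
have adE B : mxvec B *m ad = mxvec (br A B).
  by rewrite mulmxBr !mul_vec_lin /= unlock linearB.
pose p := char_poly ad.
have p0 : p != 0 by apply: monic_neq0; exact: char_poly_monic.
have [k0 Hk0] : exists k0, forall k, (k0 <= k)%N -> ~~ root p (k%:R * c).
  have [s Hs] : exists s : seq nat, forall k, root p (k%:R * c) -> k \in s.
    have : forall t : seq nat, uniq t -> all (root p) [seq k%:R * c | k <- t] ->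
       (size t < size p)%N.
      move=> t ut rt; rewrite -(size_map (fun k => k%:R * c)).
      apply: max_poly_roots => //; rewrite map_inj_uniq // => i j /(mulIf c0).
      by move/eqP; rewrite eqr_nat => /eqP.
    move: (size p) => m; elim: m => [|m IH] Hm.
      by have := Hm [::] isT isT.
    have [[t [ut rt mt]]|none] := pselect (exists t : seq nat,
        [/\ uniq t, all (root p) [seq k%:R * c | k <- t] & (m <= size t)%N]).
      exists t => k rk; apply: contraT => kt.
      have := Hm (k :: t); rewrite /= kt ut rk rt => /(_ isT isT).
      by rewrite ltnS ltnNge mt.
    apply: IH => t ut rt; rewrite ltnNge; apply/negP => mt; apply: none.
    by exists t.
  exists (\max_(k <- s) k).+1 => k kk; apply/negP => /Hs ks.
  by have := @leq_bigmax_seq _ s xpredT id k ks isT; rewrite leqNgt => /negP; apply.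
exists k0 => k B /Hk0 nr brAB; apply/eqP; apply: contraNT nr => B0.
rewrite -eigenvalue_root_char; apply/eigenvalueP; exists (mxvec B).
  by rewrite adE brAB linearZ.
by rewrite mxvec_eq0.
Qed.

(** The powers of [B] are eigenvectors of [br A], for the multiples of [c]. *)
Lemma ad_eigenvector_nilpotent A B (c : C) :
  c != 0 -> br A B = c *: B -> exists k, B ^+ k = 0.
Proof.
move=> c0 AB; have [k0 Hk0] := ad_eigenvalue_bound A c0.
by exists k0; apply: (Hk0 k0) => //; exact: brX.
Qed.

(** A nonzero stable subspace of minimal dimension is contained in the kernel
    of each of the matrices, since that kernel cuts out of it a nonzero stable
    subspace. *)
Lemma commuting_nilpotent_common_kernel (S : set 'M[C]_n.+1) :
    (forall A, S A -> exists k, A ^+ k = 0) ->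
    (forall A B, S A -> S B -> br A B = 0) ->
  exists2 v : 'cV[C]_n.+1, v != 0 & forall A, S A -> A *m v = 0.
Proof.
move=> Snil Scomm.
(* the row space of [W], for the transposed matrices, encodes a stable subspace *)
pose P k := `[< exists W : 'M[C]_n.+1, [/\ W != 0, \rank W = k &
  forall A, S A -> (W *m A^T <= W)%MS] >].
have exP : exists k, P k.
  exists n.+1; apply/asboolP; exists 1%:M; split.
  - by rewrite oner_neq0.
  - exact: mxrank1.
  - by move=> A _; rewrite submx1.
have [k /asboolP [W [W0 rW sW]] minW] := ex_minnP exP.
have kerW A : S A -> W *m A^T = 0.
  move=> SA; have [m Am] := Snil _ SA.
  have exm : exists m, W *m (A^T ^+ m) == 0.
    exists m; have -> : A^T ^+ m = (A ^+ m)^T.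
      elim: (m) => [|j IH]; first by rewrite !expr0 trmx1.
      by rewrite exprSr IH exprS [RHS]trmx_mul.
    by rewrite Am trmx0 mulmx0.
  have [j /eqP Wj minj] := ex_minnP exm.
  case: j Wj minj => [|j] Wj minj.
    by move: W0; rewrite -[W]mulmx1 -[1%:M]/(A^T ^+ 0) Wj eqxx.
  pose W' := (W :&: kermx A^T)%MS.
  have stab i : (W *m A^T ^+ i <= W)%MS.
    elim: i => [|i IH]; first by rewrite expr0 mulmx1.
    rewrite exprSr mulmxA; apply: submx_trans (sW _ SA); exact: submxMr.
  have W'0 : W' != 0.
    have : W *m A^T ^+ j != 0.
      by apply/negP => /minj; rewrite ltnn.
    apply: contraNneq => W'0; rewrite -submx0 -W'0 sub_capmx stab /=.
    by apply/sub_kermxP; rewrite -mulmxA -[A^T ^+ j *m _]/(A^T ^+ j * A^T) -exprSr.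
  have rW' : (k <= \rank W')%N.
    apply: minW; apply/asboolP; exists W'; split=> // B SB.
    rewrite sub_capmx (submx_trans (submxMr _ (capmxSl _ _)) (sW _ SB)) /=.
    apply/sub_kermxP; rewrite -mulmxA.
    have -> : B^T *m A^T = A^T *m B^T.
      rewrite -!trmx_mul; congr (_^T).
      by apply/eqP; rewrite -subr_eq0; have := Scomm _ _ SA SB; rewrite unlock => ->.
    rewrite mulmxA (_ : W' *m A^T = 0) ?mul0mx //.
    by apply/sub_kermxP; exact: capmxSr.
  apply/sub_kermxP; apply: submx_trans (capmxSr W _).
  have := mxrank_leqif_sup (capmxSl W (kermx A^T)); rewrite -/W' rW.
  by move=> [le <-]; rewrite eqn_leq le.
have [v vW v0] : exists2 v : 'rV[C]_n.+1, (v <= W)%MS & v != 0.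
  by have /rowV0Pn := W0.
exists v^T; first by rewrite trmx_eq0.
move=> A SA; apply: trmx_inj; rewrite trmx_mul trmxK trmx0.
by have /submxP [D ->] := vW; rewrite -mulmxA kerW // mulmx0.
Qed.

End NilpotentMatrices.

(** * Irreducible families of matrices *)

Section Irreducible.
Variables (C : numClosedFieldType) (n : nat).
Implicit Types (A B : 'M[C]_n.+1) (v : 'cV[C]_n.+1) (O S : set 'M[C]_n.+1).

(** Subspaces are predicates: they are compared with submodules of [T], which are
    predicates too. *)
Definition irreducible_family O := forall P : set 'cV[C]_n.+1,
  P 0 -> (forall a u v, P u -> P v -> P (a *: u + v)) ->
  (forall A v, O A -> P v -> P (A *m v)) ->
  (exists2 v, v != 0 & P v) -> forall v, P v.

(** The common kernel of [S] is nonzero and stable under the irreducible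
    family, hence is everything. *)
Lemma commuting_nilpotent_eq0 O S : irreducible_family O ->
    (forall A, S A -> exists k, A ^+ k = 0) ->
    (forall A B, S A -> S B -> br A B = 0) ->
    (forall v, (forall A, S A -> A *m v = 0) ->
       forall A B, O A -> S B -> br A B *m v = 0) ->
  forall A, S A -> A = 0.
Proof.
move=> iO Snil Scomm Sker A SA.
have [v v0 Sv] := commuting_nilpotent_common_kernel Snil Scomm.
have kerT : forall u : 'cV[C]_n.+1, forall B, S B -> B *m u = 0.
  apply: (iO (fun u => forall B, S B -> B *m u = 0)).
  - by move=> B _; rewrite mulmx0.
  - by move=> a u w Su Sw B SB; rewrite mulmxDr -scalemxAr Su // Sw // scaler0 addr0.
  - move=> B u OB Su D SD; rewrite br_mulmx Su // mulmx0 add0r brC mulNmx.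
    by rewrite (Sker u) ?oppr0.
  - by exists v.
apply/matrixP => i j; have := kerT (delta_mx j 0) A SA.
by rewrite -colE => /colP /(_ i); rewrite !mxE.
Qed.

(** An eigenspace of [B] is stable under all matrices that commute with [B]. *)
Lemma schur_scalar O B : irreducible_family O ->
  (forall A, O A -> br A B = 0) -> exists c, B = c%:M.
Proof.
move=> iO OB.
have [c rc] : exists c, root (char_poly B^T) c.
  by apply/closed_rootP; rewrite size_char_poly.
have := rc; rewrite -eigenvalue_root_char => /eigenvalueP [v vB v0].
have ker : forall u : 'cV[C]_n.+1, (B - c%:M) *m u = 0.
  apply: iO.
  - by rewrite mulmx0.
  - by move=> a u w Bu Bw; rewrite mulmxDr -scalemxAr Bu Bw scaler0 addr0.
  - move=> A u OA Bu; rewrite br_mulmx Bu mulmx0 add0r.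
    by rewrite brBl br_scalarl subr0 brC OB // oppr0 mul0mx.
  - exists v^T; first by rewrite trmx_eq0.
    apply: trmx_inj; rewrite trmx_mul trmxK raddfB /= mulmxBr vB.
    by rewrite tr_scalar_mx mul_mx_scalar subrr trmx0.
exists c; apply/eqP; rewrite -subr_eq0; apply/eqP/matrixP => i j.
by have := ker (delta_mx j 0); rewrite -colE => /colP /(_ i); rewrite !mxE.
Qed.

End Irreducible.

(** * Finite differences on an abelian group *)

Section Differences.
Variables (G V : zmodType).
Implicit Types (f g : G -> V) (a b x : G) (s : seq G).

Definition dif b f : G -> V := fun x => f (x + b) - f x.

Definition difs s f : G -> V := foldr dif f s.

(** This says that [f] is polynomial of degree less than [n]. *)
Definition difs_vanish n f := forall s, size s = n -> forall x, difs s f x = 0.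

Lemma difC a b f : dif a (dif b f) = dif b (dif a f).
Proof.
apply/funext => x; rewrite /dif [x + a + b]addrAC !opprB addrACA.
by rewrite [- _ - _]addrC addrACA.
Qed.

Lemma dif_addl a b f x : dif (a + b) f x = dif a f (x + b) + dif b f x.
Proof. by rewrite /dif addrA addrAC [x + b + a]addrAC addrA subrK. Qed.

Lemma dif_shift b f x : f (x + b) = f x + dif b f x.
Proof. by rewrite /dif addrCA subrr addr0. Qed.

Lemma difs_nseq n b f : difs (nseq n b) f = iter n (dif b) f.
Proof. by elim: n => //= n ->. Qed.

Lemma difs_cons a s f : difs (a :: s) f = difs s (dif a f).
Proof. by elim: s => //= b s <-; rewrite difC. Qed.

Lemma difs_shift c s f x : difs s (fun y => f (y + c)) x = difs s f (x + c).
Proof. by elim: s x => //= b s IH x; rewrite /dif !IH addrAC. Qed.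

Lemma difsD s f g x :
  difs s (fun y => f y + g y) x = difs s f x + difs s g x.
Proof. by elim: s x => //= b s IH x; rewrite /dif !IH opprD addrACA. Qed.

Lemma difs_vanish_dif n f :
  (forall b, difs_vanish n (dif b f)) -> difs_vanish n.+1 f.
Proof. by move=> fn [//|a s] [sn] x; rewrite difs_cons; exact: fn. Qed.

Lemma dif_difs_vanish n f b : difs_vanish n.+1 f -> difs_vanish n (dif b f).
Proof. by move=> fn s sn x; rewrite -difs_cons; apply: fn; rewrite /= sn. Qed.

Lemma difs_vanishS n f : difs_vanish n f -> difs_vanish n.+1 f.
Proof.
move=> fn [//|a s] [sn] x; rewrite /= /dif.
by rewrite !fn // subrr.
Qed.

Lemma difs_vanish_leq m n f : (m <= n)%N -> difs_vanish m f -> difs_vanish n f.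
Proof.
by move/subnK <-; elim: (n - m)%N => //= k IH /IH; exact: difs_vanishS.
Qed.

Lemma iter_dif_constant n b f x :
  (forall y, f (y + b) = f y) -> iter n.+1 (dif b) f x = 0.
Proof.
move=> fb; rewrite iterSr; have -> : dif b f = fun=> 0.
  by apply/funext => y; rewrite /dif fb subrr.
elim: n x => //= n IH x; by rewrite /dif !IH subrr.
Qed.

(** A difference along [h + e *~ k] is the sum of a difference along [h] and of
    one along [e *~ k]; the first lowers the order of vanishing [p] along [H],
    the second the order [q] along [e]. *)
Lemma difs_vanish_join (H H' : set G) (e : G) p q f :
    (forall b, H' b -> exists h (k : int), H h /\ b = h + e *~ k) ->
    (forall s, size s = p -> (forall b, b \in s -> H b) ->
       forall x, difs s f x = 0) ->
    (forall x, iter q (dif e) f x = 0) ->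
  forall s, size s = (p + q)%N -> (forall b, b \in s -> H' b) ->
       forall x, difs s f x = 0.
Proof.
move=> HH'; move: {2}(p + q)%N (erefl (p + q)%N) => m.
elim: m p q f => [|m IH] p q f pq Hp Hq s.
  move/eqP: pq Hp; rewrite addn_eq0 => /andP [/eqP -> /eqP ->] Hp.
  by case: s => // _ _ x; exact: (Hp [::]).
have [p0|p_gt0] := posnP p.
  move: Hp; rewrite p0 => Hp _ _ x.
  have -> : f = fun=> 0 by apply/funext => y; exact: (Hp [::]).
  by elim: s x => //= b s IHs x; rewrite /dif !IHs subrr.
have [q0|q_gt0] := posnP q.
  move: Hq; rewrite q0 => Hq _ _ x.
  have -> : f = fun=> 0 by apply/funext => y; exact: Hq.
  by elim: s x => //= b s IHs x; rewrite /dif !IHs subrr.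
rewrite pq; case: s => // b s [ss] sH x.
have [h [k [Hh ->]]] := HH' b (sH b (mem_head _ _)).
have sH' c : c \in s -> H' c by move=> cs; apply: sH; rewrite inE cs orbT.
rewrite difs_cons.
have -> : dif (h + e *~ k) f =
    (fun y => dif h f (y + e *~ k) + dif (e *~ k) f y).
  by apply/funext => y; exact: dif_addl.
rewrite difsD difs_shift.
rewrite (IH p.-1 q (dif h f)) ?add0r //.
- apply: (IH p q.-1 (dif (e *~ k) f)) => //.
  + by move: pq; rewrite -{1}(prednK q_gt0) addnS => -[].
  + by move=> t tp tH y; rewrite -difs_cons /= /dif !Hp // subrr.
  + move=> y; have dC j : iter q.-1 (dif e) (dif j f) =
        dif j (iter q.-1 (dif e) f).
      by rewrite -!difs_nseq -difs_cons.
    rewrite dC /dif; set g := iter _ _ _.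
    have ge z : g (z + e) = g z.
      by apply/eqP; rewrite -subr_eq0 -[_ - _]/(dif e g z) -iterS prednK ?Hq.
    have gn (j : nat) z : g (z + e *+ j) = g z.
      by elim: j => [|j IHj]; rewrite ?mulr0n ?addr0 // mulrSr addrA ge.
    apply/eqP; rewrite subr_eq0; apply/eqP.
    by case: k {sH Hh ss} => j; rewrite ?gn // NegzE -[in RHS](subrK (e *+ j.+1) y) gn.
  + by move: pq; rewrite -{1}(prednK q_gt0) addnS => -[->].
- by move: pq; rewrite -{1}(prednK p_gt0) addSn => -[].
- move=> t tp tH y; rewrite -difs_cons; apply: Hp; first by rewrite /= tp prednK.
  by move=> c; rewrite inE => /predU1P [->|/tH].
- move=> y; have -> : iter q (dif e) (dif h f) = dif h (iter q (dif e) f).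
    by rewrite -!difs_nseq -difs_cons.
  by rewrite /dif !Hq subrr.
- by move: pq; rewrite -{1}(prednK p_gt0) addSn => -[->].
Qed.

End Differences.

(** Nilpotency along each direction is assumed with exponents that may depend on
    the direction; the sum of those of the coordinate directions bounds the
    degree, one coordinate being adjoined at a time. *)
Lemma difs_vanish_generators N (V : zmodType) (f : 'rV[int]_N -> V) :
    (forall b, exists q, forall x, iter q (dif b) f x = 0) ->
  exists n, difs_vanish n f.
Proof.
move=> fb.
have Hj j : (j <= N)%N -> exists n, forall s : seq 'rV[int]_N, size s = n ->
    (forall b, b \in s -> forall i : 'I_N, (j <= i)%N -> b 0 i = 0) ->
    forall x, difs s f x = 0; last first.
  have [n Hn] := Hj N (leqnn N); exists n => s sn; apply: Hn => // b _ i.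
  by rewrite leqNgt ltn_ord.
elim: j => [|j IH] jN.
  exists 1%N => -[//|b [|//]] _ sb x; rewrite /= /dif.
  have -> : b = 0.
    by apply/rowP => i; rewrite !mxE (sb b) // mem_head.
  by rewrite addr0 subrr.
have [p Hp] := IH (ltnW jN).
have [q Hq] := fb (delta_mx 0 (Ordinal jN)).
exists (p + q)%N => s ss sH x.
pose H' (b : 'rV[int]_N) := forall i : 'I_N, (j.+1 <= i)%N -> b 0 i = 0.
apply: (difs_vanish_join (H' := H') _ Hp Hq ss sH).
move=> b Hb; exists (b - delta_mx 0 (Ordinal jN) *~ b 0 (Ordinal jN)).
exists (b 0 (Ordinal jN)); split; last by rewrite subrK.
move=> i ji; rewrite !mxE -scaler_int !mxE.
have [->|iN] := eqVneq i (Ordinal jN).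
  by rewrite /= mulr1 intz subrr.
rewrite andbF mulr0 subr0; apply: Hb; rewrite ltn_neqAle ji andbT.
by apply: contraNneq iN => ij; apply/eqP/val_inj.
Qed.

Section DifferencesOfProducts.
Variables (K : comNzRingType) (G : zmodType) (V : lmodType K).

(** Leibniz rule for a factor [l] that is affine along [b]. *)
Lemma iter_dif_affineM (l : G -> K) (f : G -> V) (b : G) c n x :
    (forall y, l (y + b) = l y + c) ->
  iter n (dif b) (fun y => l y *: f y) x =
  l x *: iter n (dif b) f x + (n%:R * c) *: iter n.-1 (dif b) f (x + b).
Proof.
move=> lb; elim: n x => [|n IH] x; first by rewrite mul0r scale0r addr0.
rewrite /= {1}/dif !IH lb.
have -> : (n%:R * c) *: iter n.-1 (dif b) f (x + b + b) =
    (n%:R * c) *: (iter n (dif b) f (x + b) + iter n.-1 (dif b) f (x + b)).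
  by case: n {IH} => [|n]; rewrite ?mul0r ?scale0r //= {2}/dif subrK.
rewrite scalerDr addrA [in X in _ - X]addrC addrKA.
rewrite [dif b (iter n _ _) x]/dif scalerBr -natr1 mulrDl mul1r !scalerDl.
by rewrite [RHS]addrAC [_ + c *: _ in RHS]addrC !addrA.
Qed.

End DifferencesOfProducts.

(** * Polarization *)

Section Polarization.
Variables (F : numFieldType) (G : zmodType).
Implicit Types (g : G -> F) (b c x y : G).

Lemma poly_nat_roots_eq0 (q : {poly F}) : (forall i : nat, q.[i%:R] = 0) -> q = 0.
Proof.
move=> q0; apply/eqP; apply: contraT => nq.
have := @max_poly_roots _ q [seq i%:R | i <- iota 0 (size q)] nq.
rewrite size_map size_iota ltnn; apply.
  by apply/allP => _ /mapP [i _ ->]; apply/rootP.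
rewrite map_inj_uniq ?iota_uniq // => i j /eqP; rewrite eqr_nat; exact/eqP.
Qed.

(** The difference along [b + i c] is the one along [b] plus [i] times the one
    along [c], up to terms of lower degree. So, for a function of degree at most
    [M], the [M]-th difference along [b + i c] is a polynomial in [i]. The two
    lowest coefficients serve the recursion and polarization. *)
Lemma iter_dif_line_poly M g b c x : difs_vanish M.+1 g ->
  exists q : {poly F},
    [/\ forall i, iter M (dif (b + c *+ i)) g x = q.[i%:R],
        q`_0 = iter M (dif b) g x &
        q`_1 = M%:R * iter M.-1 (dif b) (dif c g) x].
Proof.
elim: M g => [|M IH] g gM.
  by exists (g x)%:P; split=> [i||]; rewrite ?hornerC // coefC ?mul0r.
have [qb [Eb b0 b1]] := IH _ (dif_difs_vanish b gM).
have [qc [Ec c0 c1]] := IH _ (dif_difs_vanish c gM).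
exists (qb + 'X * qc); split=> [i||].
- have [h [hE hM]] : exists h : G -> F,
      (forall y, dif (b + c *+ i) g y = (dif b g y + i%:R * dif c g y) + h y) /\
      difs_vanish M h.
    elim: i => [|i [h [hE hM]]].
      exists (fun=> 0); split=> [y|s ss y].
        by rewrite mulr0n addr0 mul0r !addr0.
      elim: s {ss} y => //= a s IHs y; by rewrite /dif !IHs subrr.
    exists (fun y => h y + dif (b + c *+ i) (dif c g) y); split.
      move=> y; rewrite (_ : b + c *+ i.+1 = c + (b + c *+ i)); last first.
        by rewrite mulrS addrCA.
      rewrite dif_addl (dif_shift _ (dif c g)) hE -natr1.
      by rewrite mulrDl mul1r; ring.
    by move=> s ss y; rewrite difsD hM // add0r;
      exact: (dif_difs_vanish _ (dif_difs_vanish _ gM)).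
  rewrite iterSr; under [dif _ g]funext do rewrite hE.
  rewrite -difs_nseq difsD [difs _ h x]hM ?size_nseq // addr0.
  rewrite (difsD _ (dif b g)) !difs_nseq.
  rewrite Eb hornerD hornerM hornerX -Ec; congr (_ + _).
  suff D k y : iter k (dif (b + c *+ i)) (fun z => i%:R * dif c g z) y =
      i%:R * iter k (dif (b + c *+ i)) (dif c g) y by exact: D.
  elim: k y => //= k IHk y; by rewrite {1}/dif !IHk [in RHS]/dif mulrBr.
- by rewrite coefD coefXM addr0 b0 -iterSr.
- rewrite coefD coefXM /= b1 c0 -natr1 mulrDl mul1r; congr (_ + _).
  by case: (M) => [|k]; rewrite ?mul0r //= difC -iterSr.
Qed.

(** The polynomial [q] of [iter_dif_line_poly] vanishes at all natural numbers,
    hence so does its coefficient of degree one, a mixed difference. *)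
Lemma scalar_polarization d g : difs_vanish d.+1 g ->
  (forall b x, iter d (dif b) g x = 0) -> difs_vanish d g.
Proof.
elim: d g => [|d IH] g gd g0.
  by move=> [|//] _ x; exact: (g0 0).
apply: difs_vanish_dif => c; apply: IH; first exact: dif_difs_vanish.
move=> b x; have [q [qE _ q1]] := iter_dif_line_poly b c x gd.
have q0 : q = 0 by apply: poly_nat_roots_eq0 => i; rewrite -qE g0.
move: q1; rewrite q0 coef0 => /esym/eqP.
by rewrite mulf_eq0 pnatr_eq0 /= => /eqP.
Qed.

Lemma difs_mxE m n (f : G -> 'M[F]_(m, n)) s x i j :
  difs s f x i j = difs s (fun y => f y i j) x.
Proof. by elim: s x => //= a s IH x; rewrite /dif !mxE !IH. Qed.

(** The [d]-th differences of a function of degree at most [d] form a symmetric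
    multi-additive form, and such a form is determined by its diagonal. *)
Lemma polarization d m n (f : G -> 'M[F]_(m, n)) : difs_vanish d.+1 f ->
  (forall b x, iter d (dif b) f x = 0) -> difs_vanish d f.
Proof.
move=> fd f0 s ss x; apply/matrixP => i j; rewrite difs_mxE mxE.
apply: (scalar_polarization (d := d) (g := fun y => f y i j)) => //.
  by move=> t tt y; rewrite -difs_mxE (fd t tt y) mxE.
by move=> b y; rewrite -difs_nseq -difs_mxE difs_nseq f0 mxE.
Qed.

End Polarization.

(** * Polynomiality *)

(** The forms [w x y] and [r x] stand for [<pi x, pi y>] and [<rho, pi x>]. *)
Section Polynomiality.
Variables (C : numClosedFieldType) (n : nat) (G : zmodType).
Variables (E : G -> 'M[C]_n.+1) (w : G -> G -> C) (r : G -> C).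
Hypothesis wDl : forall x y z, w (x + y) z = w x z + w y z.
Hypothesis wC : forall x y, w x y = - w y x.
Hypothesis rD : forall x y, r (x + y) = r x + r y.
Hypothesis Ebr : forall x y, br (E x) (E y) =
  (w x y + r y - r x) *: E (x + y) - (w x y + r y) *: E y
  + (r x - w x y) *: E x.
Implicit Types x y z b : G.

Lemma formDr x y z : w x (y + z) = w x y + w x z.
Proof. by rewrite ![w x _]wC wDl opprD. Qed.

Lemma form_alt x : w x x = 0.
Proof.
have /eqP := wC x x; rewrite -subr_eq0 opprK -mulr2n -mulr_natl mulf_eq0.
by rewrite pnatr_eq0 => /eqP.
Qed.

Lemma form0r x : w x 0 = 0.
Proof. by apply: (addrI (w x 0)); rewrite -formDr !addr0. Qed.

Lemma form0l x : w 0 x = 0.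
Proof. by rewrite wC form0r oppr0. Qed.

Lemma formN x y : w (- x) y = - w x y.
Proof. by apply: (addrI (w x y)); rewrite -wDl !subrr form0l. Qed.

Lemma lin0 : r 0 = 0.
Proof. by apply: (addrI (r 0)); rewrite -rD !addr0. Qed.

Lemma linN x : r (- x) = - r x.
Proof. by apply: (addrI (r x)); rewrite -rD !subrr lin0. Qed.

Lemma formMn x y k : w (x *+ k) y = k%:R * w x y.
Proof.
elim: k => [|k IH]; first by rewrite mulr0n form0l mul0r.
by rewrite mulrS wDl IH -[in RHS]natr1; ring.
Qed.

Lemma linMn x k : r (x *+ k) = k%:R * r x.
Proof.
elim: k => [|k IH]; first by rewrite mulr0n lin0 mul0r.
by rewrite mulrS rD IH -[in RHS]natr1; ring.
Qed.

Local Notation D k b := (iter k (dif b) E).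

Lemma br_iter_dif k b y A :
  br A (D k b y) = iter k (dif b) (fun z => br A (E z)) y.
Proof. by elim: k y => //= k IH y; rewrite {1}/dif brBr !IH. Qed.

(** The relation [Ebr], differenced in [y]: the coefficients of [E (x + y)] and
    [E y] are affine, and two differences suffice to remove the term in [E x]. *)
Lemma iter_dif_br k x b y : br (E x) (D k.+2 b y) =
  (w x y + r y - r x) *: D k.+2 b (x + y) - (w x y + r y) *: D k.+2 b y
  + (k.+2%:R * (w x b + r b)) *: (D k.+1 b (x + y + b) - D k.+1 b (y + b)).
Proof.
rewrite br_iter_dif.
have -> : (fun z => br (E x) (E z)) = (fun z =>
    (w x z + r z - r x) *: E (z + x) + (- (w x z + r z)) *: E z
    + (r x - w x z) *: E x).
  by apply/funext => z; rewrite Ebr scaleNr [z + x]addrC.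
rewrite -difs_nseq difsD (difsD _ (fun z => (w x z + r z - r x) *: E (z + x))).
rewrite !difs_nseq.
rewrite (iter_dif_affineM _ _ (c := w x b + r b)); last first.
  by move=> z; rewrite formDr rD; ring.
rewrite (iter_dif_affineM _ _ (c := - (w x b + r b))); last first.
  by move=> z; rewrite formDr rD; ring.
rewrite (iter_dif_affineM _ _ (c := - w x b)); last first.
  by move=> z; rewrite formDr; ring.
rewrite !(@iter_dif_constant _ _ _ _ (fun=> E x)) // !scaler0 !addr0.
rewrite -!difs_nseq !difs_shift !difs_nseq [y + x]addrC.
rewrite [y + b + x]addrC [x + (y + b)]addrA.
move: (D k.+2 b (x + y)) (D k.+2 b y) => M1 M2.
move: (iter k.+2.-1 (dif b) E (x + y + b)) (iter k.+2.-1 (dif b) E (y + b)).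
by move=> M3 M4; apply/matrixP => i j; rewrite !mxE; ring.
Qed.

Hypothesis r_neq0 : forall x, x != 0 -> r x != 0.

(** On the line of direction [b], with coordinate [t = e^b], the matrix [E (- b)]
    corresponds to the vector field [(t^-1 - 1) t d/dt] up to the factor [r b]:
    the shift [y - b] is [t^-1], and [k] comes from the order of the zero at
    [t = 1] of the [k]-th difference. *)
Lemma iter_dif_euler k b y : br (E (- b)) (D k.+2 b y) =
  (r y + r b - w b y) *: D k.+2 b (y - b)
  - (r y - w b y + k.+2%:R * r b) *: D k.+2 b y.
Proof.
rewrite iter_dif_br !formN form_alt linN oppr0 add0r addrC [- b + y]addrC subrK.
have -> : D k.+1 b y - D k.+1 b (y + b) = - D k.+2 b y.
  by rewrite -[D k.+2 b y]/(D k.+1 b (y + b) - D k.+1 b y) opprB.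
move: (D k.+2 b y) (D k.+2 b (y - b)) => M1 M2.
by apply/matrixP => i j; rewrite !mxE; ring.
Qed.

(** [D k b (- b)] is an eigenvector of [br (E (- b))] for the eigenvalue
    [- (k - 1) r b], as a vector field with a zero of order [k] is for the Euler
    field; these eigenvalues are infinitely many. *)
Lemma iter_dif_opp_eq0 b : b != 0 -> exists k0, forall k, (k0 <= k)%N ->
  D k b (- b) = 0.
Proof.
move=> b0.
have rb0 : - r b != 0 by rewrite oppr_eq0 r_neq0.
have [k0 Hk0] := ad_eigenvalue_bound (E (- b)) rb0.
exists k0.+2 => -[//|[//|k]]; rewrite !ltnS => kk0; apply: (Hk0 k.+1).
  exact: leq_trans kk0 _.
rewrite iter_dif_euler linN (wC b) formN form_alt !oppr0 addNr !addr0 scale0r add0r.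
by rewrite -scaleNr; congr (_ *: _); rewrite -natr1; ring.
Qed.

(** From the multiple [- b] of [b] to all the multiples: upwards because a
    difference computes the value at the next point, downwards by
    [iter_dif_euler]. *)
Lemma iter_dif_line_eq0 b : b != 0 -> exists k0, forall k (j : int),
  (k0 <= k)%N -> D k b (b *~ j) = 0.
Proof.
move=> b0; have [k0 Hk0] := iter_dif_opp_eq0 b0.
have up (j k : nat) : (k0 <= k)%N -> D k b (b *+ j - b) = 0.
  elim: j k => [|j IH] k kk0; first by rewrite mulr0n add0r Hk0.
  rewrite mulrSr addrAC dif_shift IH // add0r -iterS IH //.
  exact: leq_trans kk0 _.
(* the coefficient [r y + r b - w b y] of [iter_dif_euler] vanishes at
   [y = - b], which makes the step from [- b] to [- b - b] a separate case *)
have dn2 k : (k0 <= k.+1)%N -> D k.+2 b (- b - b) = 0.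
  move=> kk0; have := iter_dif_br k (- b - b) b 0.
  have -> : D k.+2 b 0 = 0.
    by have := up 1%N k.+2; rewrite mulr1n subrr; apply; exact: leq_trans kk0 _.
  have -> : D k.+1 b (0 + b) = 0.
    by have := up 2%N k.+1; rewrite mulr2n addrK add0r; exact.
  have -> : D k.+1 b (- b - b + 0 + b) = 0 by rewrite addr0 subrK Hk0.
  rewrite br0r form0r lin0 !addr0 subrr !scaler0 subr0 addr0 add0r rD linN.
  move/esym/eqP; rewrite scaler_eq0 => /orP [|/eqP //].
  by rewrite opprD opprK -mulr2n -mulr_natl mulf_eq0 pnatr_eq0 (negPf (r_neq0 b0)).
have dn k (j : nat) : (k0 <= k.+1)%N -> D k.+2 b (- (b *+ j.+1)) = 0.
  move=> kk0; elim: j => [|j IH].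
    by rewrite mulr1n Hk0 //; exact: leq_trans kk0 _.
  case: j IH => [|j] IH; first by rewrite mulr2n opprD dn2.
  have := iter_dif_euler k b (- (b *+ j.+2)); rewrite IH br0r scaler0 subr0.
  have -> : r (- (b *+ j.+2)) + r b - w b (- (b *+ j.+2)) = - (j.+1%:R * r b).
    by rewrite linN [w b _]wC formN opprK formMn form_alt linMn -natr1; ring.
  rewrite -opprD -mulrSr => /esym/eqP; rewrite scaler_eq0 oppr_eq0 mulf_eq0.
  by rewrite pnatr_eq0 (negPf (r_neq0 b0)) => /eqP.
exists k0.+2 => -[//|[//|k]] [j|j] kk0.
  rewrite -[b *~ j](addrK b) -[b *~ j + b]/(b *+ j + b) -mulrSr up //.
  by do 2!apply: ltnW.
by rewrite -[b *~ _]/(- (b *+ j.+1)) dn //; exact: leqW.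
Qed.

Hypothesis wr_neq0 : forall z b, b != 0 -> w z b + 2 * r b != 0.

(** The brackets of [E y] with [E 0] and [E b], differenced along [b] in the second
    argument, give two linear relations between the same two differences of [E]
    near [z]; subtracting them leaves [w z b + 2 * r b] times one of the
    differences. *)
Lemma iter_dif_eq0 b : b != 0 -> exists k, forall z, D k b z = 0.
Proof.
move=> b0; have [k0 Hk0] := iter_dif_line_eq0 b0.
exists k0.+2 => z.
have D0 k j : (k0 <= k)%N -> D k b (b *+ j) = 0.
  by move=> kk0; rewrite pmulrn Hk0.
have rel y j : (w y (b *+ j) + r (b *+ j) - r y) *: D k0.+2 b (y + b *+ j)
    + (k0.+2%:R * (w y b + r b)) *: D k0.+1 b (y + b *+ j + b) = 0.
  have := iter_dif_br k0 y b (b *+ j).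
  rewrite D0 ?br0r ?scaler0 ?subr0; last by do 2!apply: leqW.
  by rewrite -mulrSr D0 ?leqW // subr0 => /esym.
have := rel z 0%N; have := rel (z - b) 1%N.
rewrite mulr1n subrK mulr0n addr0 form0r lin0 !add0r => e1 e2.
have := e1; rewrite -[RHS]e2 => /eqP; rewrite -subr_eq0.
have -> : w (z - b) b = w z b by rewrite wDl formN form_alt oppr0 addr0.
rewrite opprD addrACA subrr addr0 -scalerBl rD linN.
have -> : w z b + r b - (r z - r b) - - r z = w z b + 2 * r b by ring.
by rewrite scaler_eq0 (negPf (wr_neq0 z b0)) => /eqP.
Qed.

End Polynomiality.

Section TopDegree.
Variables (C : numClosedFieldType) (n : nat) (G : zmodType).
Variables (E : G -> 'M[C]_n.+1) (w : G -> G -> C) (r : G -> C).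
Hypothesis wDl : forall x y z, w (x + y) z = w x z + w y z.
Hypothesis wC : forall x y, w x y = - w y x.
Hypothesis rD : forall x y, r (x + y) = r x + r y.
Hypothesis Ebr : forall x y, br (E x) (E y) =
  (w x y + r y - r x) *: E (x + y) - (w x y + r y) *: E y
  + (r x - w x y) *: E x.
Hypothesis r_neq0 : forall x, x != 0 -> r x != 0.
Hypothesis irrE : irreducible_family (range E).
Local Notation D k b := (iter k (dif b) E).

Lemma difs_const (V : zmodType) (f : G -> V) s x y :
  difs_vanish (size s).+1 f -> difs s f x = difs s f y.
Proof.
move=> fs; have := fs ((x - y) :: s) erefl y.
by rewrite /= /dif [y + _]addrC subrK => /eqP; rewrite subr_eq0 => /eqP.
Qed.

Lemma difs_brl (f : G -> 'M[C]_n.+1) A s x :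
  br (difs s f x) A = difs s (fun y => br (f y) A) x.
Proof. by elim: s x => //= a s IH x; rewrite /dif brBl !IH. Qed.

Lemma difs_mulmx (f : G -> 'M[C]_n.+1) (v : 'cV[C]_n.+1) s x :
  difs s (fun y => f y *m v) x = difs s f x *m v.
Proof. by elim: s x => //= a s IH x; rewrite /dif !IH mulmxBl. Qed.

(** Let [d = k + 3] be a bound for the degree of [E]. The differences
    [D d b] are constants [T b], the values of the leading form. They are
    nilpotent, being eigenvectors of [br (E b)]; they commute, because
    [br (T c) (T b)] is a [d]-th difference of a function of degree two; and their
    common kernel is stable, by polarization. *)
Lemma difs_vanish_pred k : difs_vanish k.+4 E -> difs_vanish k.+3 E.
Proof.
move=> Ek; pose T b := D k.+3 b 0.
have DT b y : D k.+3 b y = T b.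
  by rewrite /T -!difs_nseq; apply: difs_const; rewrite size_nseq.
pose S x b := dif x (D k.+2 b) 0.
have DS x b y : dif x (D k.+2 b) y = S x b.
  rewrite /S -difs_nseq -[dif x _]/(difs (x :: nseq k.+2 b) E).
  by apply: difs_const; rewrite /= size_nseq.
have brT x b : br (E x) (T b) =
    - r x *: T b + (k.+3%:R * (w x b + r b)) *: S x b.
  have := iter_dif_br wDl wC rD Ebr k.+1 x b 0; rewrite !DT => ->.
  rewrite (form0r wDl wC) (lin0 rD) !add0r scale0r subr0 addr0.
  by rewrite -(DS x b b) [dif x _ b]/dif [x + b]addrC.
have SD x c b : S (x + c) b = S x b + S c b.
  by rewrite /S dif_addl !DS.
have Tnil b : exists m, T b ^+ m = 0.
  have [->|b0] := eqVneq b 0.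
    by exists 1%N; rewrite expr1 /T iterSr iter_dif_constant // => y; rewrite addr0.
  have c0 : k.+2%:R * r b != 0 by rewrite mulf_neq0 ?pnatr_eq0 ?r_neq0.
  apply: (ad_eigenvector_nilpotent (A := E b) c0).
  rewrite brT (form_alt wC) add0r (_ : S b b = T b) // -scalerDl.
  by congr (_ *: _); rewrite -[k.+3%:R]natr1; ring.
have TC c b : br (T c) (T b) = 0.
  have -> : br (T c) (T b) = iter k.+3 (dif c) (fun x => br (E x) (T b)) 0.
    by rewrite -difs_nseq -difs_brl difs_nseq.
  have -> : (fun x => br (E x) (T b)) = (fun x =>
      (- r x) *: T b + (k.+3%:R * (w x b + r b)) *: S x b).
    by apply/funext => x.
  rewrite -difs_nseq difsD !difs_nseq.
  rewrite (iter_dif_affineM _ _ (c := - r c)); last by move=> x; rewrite rD opprD.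
  rewrite (iter_dif_affineM _ _ (c := k.+3%:R * w c b)); last first.
    by move=> x; rewrite wDl; ring.
  rewrite !(@iter_dif_constant _ _ _ _ (fun=> T b)) // !scaler0 !add0r.
  have S0 m y : iter m.+2 (dif c) (S^~ b) y = 0.
    have dS z : dif c (S^~ b) z = S c b by rewrite /dif SD addrC addKr.
    by rewrite iterSr; apply: iter_dif_constant => z; rewrite !dS.
  by rewrite !S0 !scaler0 addr0.
have T0 b : T b = 0.
  apply: (commuting_nilpotent_eq0 irrE (S := range T)) => //.
  - by move=> _ [c _ <-].
  - by move=> _ _ [c _ <-] [c' _ <-].
  - move=> v Tv _ _ [x _ <-] [c _ <-].
    rewrite brT mulmxDl -!scalemxAl Tv; last by exists c.
    suff -> : S x c *m v = 0 by rewrite !scaler0 addr0.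
    have fk : difs_vanish k.+3 (fun y => E y *m v).
      apply: polarization => [s ss y|c' y].
        by rewrite difs_mulmx Ek // mul0mx.
      by rewrite -difs_nseq difs_mulmx difs_nseq DT Tv //; exists c'.
    rewrite /S -difs_nseq -[dif x _]/(difs (x :: nseq k.+2 c) E) -difs_mulmx.
    by apply: fk; rewrite /= size_nseq.
by apply: polarization => // b x; rewrite DT.
Qed.

Lemma difs_vanish3 m : difs_vanish m E -> difs_vanish 3 E.
Proof.
elim: m => [|m IH] Em; first exact: difs_vanish_leq Em.
have [m3|] := leqP m.+1 3; first exact: difs_vanish_leq Em.
by case: m IH Em => [|[|[|k]]] // IH Em _; apply: IH; exact: difs_vanish_pred.
Qed.

End TopDegree.

(** * The quadratic expansion *)

(** For a goal that is a consequence of one equation: the remaining identity is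
    left to [mx_ring]. *)
Lemma eq_lincomb (V : zmodType) (X Y P Q : V) : X = Y -> P - Q = X - Y -> P = Q.
Proof. by move=> -> /eqP; rewrite subrr subr_eq0 => /eqP. Qed.

Ltac mx_ring := let i := fresh in let j := fresh in
  apply/matrixP => i j; rewrite !mxE; ring.

Section Quadratic.
Variables (C : numClosedFieldType) (n : nat) (G : zmodType).
Variables (E : G -> 'M[C]_n.+1) (w : G -> G -> C) (r : G -> C).
Hypothesis wDl : forall x y z, w (x + y) z = w x z + w y z.
Hypothesis wC : forall x y, w x y = - w y x.
Hypothesis rD : forall x y, r (x + y) = r x + r y.
Hypothesis Ebr : forall x y, br (E x) (E y) =
  (w x y + r y - r x) *: E (x + y) - (w x y + r y) *: E y
  + (r x - w x y) *: E x.

Lemma quadratic_expansion : difs_vanish 3 E ->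
  exists (L : G -> 'M[C]_n.+1) (B : G -> G -> 'M[C]_n.+1),
  [/\ forall x y, L (x + y) = L x + L y, forall x y, B x y = B y x,
      forall x y z, B (x + y) z = B x z + B y z &
      forall x, E x = E 0 + L x + B x x].
Proof.
move=> E3.
have dd x y z : dif x (dif y E) z = dif x (dif y E) 0.
  exact: (difs_const (s := [:: x; y])).
have h2 : (2 : C)^-1 + 2^-1 = 1 by rewrite -div1r -splitr.
have [B [B2 BC BD]] : exists B : G -> G -> 'M[C]_n.+1,
    [/\ forall x y, B x y + B x y = dif x (dif y E) 0,
        forall x y, B x y = B y x & forall x y z, B (x + y) z = B x z + B y z].
  exists (fun x y => 2^-1 *: dif x (dif y E) 0); split=> [x y|x y|x y z].
  - by rewrite -scalerDl h2 scale1r.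
  - by rewrite difC.
  - by rewrite dif_addl dd scalerDr.
exists (fun x => E x - E 0 - B x x), B; split=> // [x y|x]; last first.
  by rewrite -[RHS]addrA subrK addrC subrK.
have := B2 x y; rewrite /dif !add0r => Exy.
have -> : E (x + y) = B x y + B x y + E x + E y - E 0.
  by rewrite Exy; apply/matrixP => i j; rewrite !mxE; ring.
rewrite !BD ![B _ (x + y)]BC !BD [B y x]BC.
move: (E x) (E y) (E 0) (B x x) (B x y) (B y y) => *.
by apply/matrixP => i j; rewrite !mxE; ring.
Qed.

Variables (L : G -> 'M[C]_n.+1) (B : G -> G -> 'M[C]_n.+1).
Hypothesis LD : forall x y, L (x + y) = L x + L y.
Hypothesis BC : forall x y, B x y = B y x.
Hypothesis BDl : forall x y z, B (x + y) z = B x z + B y z.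
Hypothesis EE : forall x, E x = E 0 + L x + B x x.

Let BDr x y z : B x (y + z) = B x y + B x z.
Proof. by rewrite ![B x _]BC BDl. Qed.

Let B0 x : B 0 x = 0.
Proof. by apply: (addrI (B 0 x)); rewrite -BDl !addr0. Qed.

Let BN x y : B (- x) y = - B x y.
Proof. by apply: (addrI (B x y)); rewrite -BDl !subrr B0. Qed.

Let LN x : L (- x) = - L x.
Proof.
apply: (addrI (L x)); rewrite -LD !subrr.
by apply: (addrI (L 0)); rewrite -LD !addr0.
Qed.

Let BNN x : B (- x) (- x) = B x x.
Proof. by rewrite BN BC BN opprK. Qed.

Let dif2E x y z : dif x (dif y E) z = 2 *: B x y.
Proof.
rewrite /dif !(EE (_ + _)) (EE z) !(LD, BDl, BDr) (BC y z) (BC y x) (BC x z).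
move: (E 0) (L x) (L y) (L z) (B x x) (B x y) (B y y) (B z y) (B z z) (B z x) => *.
by apply/matrixP => i j; rewrite !mxE; ring.
Qed.

(** The components of degree one and two in [x] of this formula are separated by
    comparing [x] with [- x]. *)
Let br_E_B x b : br (E x) (B b b) = - r x *: B b b + (2 * (w x b + r b)) *: B x b.
Proof.
apply: (scalerI (a := 2)); first by rewrite pnatr_eq0.
rewrite -brZr -(dif2E b b 0) -[dif b _]/(iter 2 (dif b) E) (iter_dif_br wDl wC rD Ebr).
have -> : iter 1 (dif b) E (x + 0 + b) - iter 1 (dif b) E (0 + b) = 2 *: B x b.
  by rewrite -(dif2E x b b) /= addr0 add0r [x + b]addrC.
rewrite [iter 2 (dif b) E _]dif2E [iter 2 (dif b) E 0]dif2E.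
rewrite (form0r wDl wC) (lin0 rD).
move: (B b b) (B x b) => *.
by apply/matrixP => i j; rewrite !mxE; ring.
Qed.

Let E0_central x : br (E 0) (E x) = 0.
Proof.
rewrite Ebr (form0l wDl wC) (lin0 rD) !add0r; move: (E x) (E 0) => *.
by apply/matrixP => i j; rewrite !mxE; ring.
Qed.

Let E0_B x : br (E 0) (B x x) = 0.
Proof. by rewrite br_E_B (lin0 rD) B0 oppr0 scale0r scaler0 addr0. Qed.

Let E0_L x : br (E 0) (L x) = 0.
Proof.
have := E0_central x; rewrite (EE x) !brDr brAA add0r.
by rewrite E0_B addr0.
Qed.

Let br_diag x b : br (L x) (B b b) = - r x *: B b b + (2 * r b) *: B x b /\
  br (B x x) (B b b) = (2 * w x b) *: B x b.
Proof.
have e1 := br_E_B x b; have e2 := br_E_B (- x) b.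
rewrite (EE x) !brDl E0_B add0r in e1.
rewrite (EE (- x)) !brDl E0_B add0r LN BNN BN brNl (formN wDl wC) (linN rD) in e2.
have e3 := congr2 (fun U V : 'M[C]_n.+1 => U - V) e1 e2.
have e4 := congr2 (fun U V : 'M[C]_n.+1 => U + V) e1 e2.
have two0 : (2 : C) != 0 by rewrite pnatr_eq0.
split; apply: (scalerI two0).
  by apply: (eq_lincomb e3); mx_ring.
by apply: (eq_lincomb e4); mx_ring.
Qed.

Lemma br_linear_quadratic x y z : br (L x) (B y z) =
  - r x *: B y z + r y *: B x z + r z *: B x y.
Proof.
have e1 := (br_diag x (y + z)).1.
rewrite !(BDl, BDr) [B z y]BC !brDr (br_diag x y).1 (br_diag x z).1 rD in e1.
apply: (scalerI (a := 2)); first by rewrite pnatr_eq0.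
by apply: (eq_lincomb e1); mx_ring.
Qed.

Let br_half x y z : br (B x x) (B y z) = w x y *: B x z + w x z *: B x y.
Proof.
have e1 := (br_diag x (y + z)).2.
rewrite !(BDl, BDr) [B z y]BC !brDr (br_diag x y).2 (br_diag x z).2 in e1.
rewrite (formDr wDl wC) in e1.
apply: (scalerI (a := 2)); first by rewrite pnatr_eq0.
by apply: (eq_lincomb e1); mx_ring.
Qed.

Lemma br_quadratic x y z t : 2 *: br (B x y) (B z t) =
  w x z *: B y t + w x t *: B y z + w y z *: B x t + w y t *: B x z.
Proof.
have e1 := br_half (x + y) z t.
rewrite !(BDl, BDr) [B y x]BC !brDl (br_half x) (br_half y) !wDl in e1.
by apply: (eq_lincomb e1); mx_ring.
Qed.

Lemma br_linear x y : br (L x) (L y) =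
  - w x y *: E 0 - r x *: L y + r y *: L x.
Proof.
have e1 := Ebr x y.
rewrite (EE x) (EE y) (EE (x + y)) !(brDl, brDr) brAA in e1.
have c0 z : br (L z) (E 0) = 0 by rewrite brC E0_L oppr0.
have c1 z : br (B z z) (E 0) = 0 by rewrite brC E0_B oppr0.
rewrite c0 c1 E0_L E0_B (br_diag x y).1 (br_diag x y).2 in e1.
rewrite (brC (B x x)) (br_diag y x).1 !(LD, BDl, BDr) (BC y x) in e1.
by apply: (eq_lincomb e1); mx_ring.
Qed.

End Quadratic.

(** * Complexification of a lattice *)

Section Complexification.
Variables (C : numClosedFieldType) (N : nat).
Local Notation G := 'rV[int]_N.
Local Notation X := 'rV[C]_N.

(** The linear extension to [C^N] of an additive function on [Z^N]. *)
Definition complexify (V : lmodType C) (f : G -> V) (u : X) : V :=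
  \sum_i u 0 i *: f (delta_mx 0 i).

Definition lattice_point (x : G) : X := map_mx intr x.

Lemma complexify_linear (V : lmodType C) (f : G -> V) : linear (complexify f).
Proof.
move=> a u v; rewrite /complexify scaler_sumr -big_split /=.
by apply: eq_bigr => i _; rewrite !mxE scalerDl scalerA.
Qed.

Lemma complexify_linearl (V : lmodType C) (f g : G -> V) a u :
  complexify (fun x => a *: f x + g x) u = a *: complexify f u + complexify g u.
Proof.
rewrite /complexify scaler_sumr -big_split /=.
by apply: eq_bigr => i _; rewrite scalerDr !scalerA mulrC.
Qed.

Lemma complexify_lattice (V : lmodType C) (f : G -> V) x :
  (forall x y, f (x + y) = f x + f y) -> complexify f (lattice_point x) = f x.
Proof.
move=> fD.
have f0 : f 0 = 0 by apply: (addrI (f 0)); rewrite -fD !addr0.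
have fN y : f (- y) = - f y by apply: (addrI (f y)); rewrite -fD !subrr.
have fn y (k : nat) : f (y *+ k) = f y *+ k.
  by elim: k => [|k IH]; rewrite ?mulr0n // !mulrS fD IH.
have fz y (k : int) : f (y *~ k) = k%:~R *: f y.
  case: k => k; first by rewrite -pmulrn fn -pmulrn scaler_nat.
  by rewrite NegzE mulrNz -pmulrn fN fn mulrNz scaleNr -pmulrn scaler_nat.
have fsum (s : seq 'I_N) (g : 'I_N -> G) :
    f (\sum_(i <- s) g i) = \sum_(i <- s) f (g i).
  by elim: s => [|i s IH]; rewrite ?big_nil // !big_cons fD IH.
rewrite {2}[x]row_sum_delta fsum; apply: eq_bigr => i _.
by rewrite mxE -fz -scaler_int intz.
Qed.

(** An identity that is linear in a vector of [C^N] need only be checked on the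
    lattice. *)
Lemma lattice_point_ind (P : X -> Prop) :
    (forall a u v, P u -> P v -> P (a *: u + v)) ->
    (forall x, P (lattice_point x)) ->
  forall u, P u.
Proof.
move=> PD Pl u.
have P0 : P 0.
  by have := PD (-1) _ _ (Pl 0) (Pl 0); rewrite scaleN1r addNr.
rewrite [u]row_sum_delta; elim: (index_enum _) => [|i s IH].
  by rewrite big_nil.
rewrite big_cons; apply: PD => //; have := Pl (delta_mx 0 i).
congr (P _); apply/rowP => j; rewrite !mxE.
by case: (_ && _).
Qed.

End Complexification.

(** * Reduction to sl2 *)

(** Here [p0] and [p1] are the coordinates of a linear map from [X] to the plane,
    of kernel [K], and [u0], [u1] lift the standard basis of the plane. *)
Section Reduction.
Variables (C : numClosedFieldType) (n : nat) (X : lmodType C).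
Variables (p0 p1 : X -> C) (L : X -> 'M[C]_n.+1) (B : X -> X -> 'M[C]_n.+1).
Variable (e0 : C).
Local Notation w u v := (p0 u * p1 v - p1 u * p0 v).
Local Notation r u := (p1 u - p0 u).
Hypothesis p0L : forall a u v, p0 (a *: u + v) = a * p0 u + p0 v.
Hypothesis p1L : forall a u v, p1 (a *: u + v) = a * p1 u + p1 v.
Hypothesis LL : forall a u v, L (a *: u + v) = a *: L u + L v.
Hypothesis BL : forall a u v t, B (a *: u + v) t = a *: B u t + B v t.
Hypothesis BC : forall u v, B u v = B v u.
Hypothesis brLL : forall u v, br (L u) (L v) =
  - w u v *: e0%:M - r u *: L v + r v *: L u.
Hypothesis brLB : forall u v t, br (L u) (B v t) =
  - r u *: B v t + r v *: B u t + r t *: B u v.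
Hypothesis brBB : forall u v s t, 2 *: br (B u v) (B s t) =
  w u s *: B v t + w u t *: B v s + w v s *: B u t + w v t *: B u s.
Variables u0 u1 : X.
Hypothesis p0u0 : p0 u0 = 1.
Hypothesis p1u0 : p1 u0 = 0.
Hypothesis p0u1 : p0 u1 = 0.
Hypothesis p1u1 : p1 u1 = 1.

Let O : set 'M[C]_n.+1 :=
  [set A | (exists u, A = L u) \/ (exists u v, A = B u v)].
Hypothesis irrO : irreducible_family O.

Let K : set X := [set u | p0 u = 0 /\ p1 u = 0].

Let two0 : (2 : C) != 0. Proof. by rewrite pnatr_eq0. Qed.

(** The eigenvectors of a commutator for a nonzero eigenvalue are nilpotent, so that
    [commuting_nilpotent_eq0] applies to them. *)
Let ideal_eq0 (S : set 'M[C]_n.+1) :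
    (forall A, S A -> A = 0 \/ exists (c : C) (D : 'M_n.+1), c != 0 /\ br D A = c *: A) ->
    (forall A D, S A -> S D -> br A D = 0) ->
    (forall v : 'cV_n.+1, (forall A, S A -> A *m v = 0) ->
       forall A D, O A -> S D -> br A D *m v = 0) ->
  forall A, S A -> A = 0.
Proof.
move=> Snil; apply: commuting_nilpotent_eq0 => // A /Snil [->|[c [D [c0 DA]]]].
  by exists 1%N; rewrite expr1.
exact: ad_eigenvector_nilpotent DA.
Qed.

(** For [k] in [K], both [w k _] and [r k] vanish. The three next facts treat the
    ideals spanned by [B K K], [B K X] and [L K] in this order, each modulo the
    previous one. *)
Let BKK k k' : K k -> K k' -> B k k' = 0.
Proof.
move=> Kk Kk'.
apply: (ideal_eq0 (S := [set A | exists k k', [/\ K k, K k' & A = B k k']]));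
  last by exists k, k'.
- move=> _ [a [b [[a0 a1] [b0 b1] ->]]]; right; exists 1, (L u0).
  split; first exact: oner_neq0.
  by rewrite brLB p0u0 p1u0 a0 a1 b0 b1; mx_ring.
- move=> _ _ [a [b [[a0 a1] [b0 b1] ->]]] [c [d [[c0 c1] [d0 d1] ->]]].
  apply: (scalerI two0); rewrite brBB a0 a1 b0 b1; mx_ring.
- move=> v Sv _ _ [[u ->]|[u [u' ->]]] [a [b [Ka Kb ->]]];
    have [[a0 a1] [b0 b1]] := (Ka, Kb).
    rewrite brLB a0 a1 b0 b1 subrr !scale0r !addr0 -scalemxAl Sv ?scaler0 //.
    by exists a, b.
  apply: (scalerI two0); rewrite scalemxAl brBB a0 a1 b0 b1.
  by rewrite !mulr0 subrr !scale0r !addr0 mul0mx scaler0.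
Qed.

Let BK k u : K k -> B k u = 0.
Proof.
move=> Kk.
apply: (ideal_eq0 (S := [set A | exists k u, K k /\ A = B k u]));
  last by exists k, u.
- move=> _ [a [b [[a0 a1] ->]]].
  have eig s : 2 *: br (B b s) (B a b) = w s b *: B a b.
    rewrite brBB a0 a1 (BC b a); mx_ring.
  have [p1b|p1b] := eqVneq (p1 b) 0; last first.
    right; exists (p1 b), (2 *: B b u0); split=> //.
    by rewrite brZl eig p0u0 p1u0 mul1r mul0r subr0.
  have [p0b|p0b] := eqVneq (p0 b) 0; first by left; exact: BKK.
  right; exists (- p0 b), (2 *: B b u1); split; first by rewrite oppr_eq0.
  by rewrite brZl eig p0u1 p1u1 mul1r mul0r sub0r.
- move=> _ _ [a [b [[a0 a1] ->]]] [c [d [[c0 c1] ->]]].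
  apply: (scalerI two0); rewrite brBB a0 a1 c0 c1 (@BKK a c) //; mx_ring.
- move=> v Sv _ _ [[u' ->]|[u' [u'' ->]]] [a [b [Ka ->]]]; have [a0 a1] := Ka.
    have Bv s : B a s *m v = 0 by apply: Sv; exists a, s.
    rewrite brLB a0 a1 (BC u' a) !mulmxDl -!scalemxAl !Bv.
    by rewrite subrr scale0r !scaler0 !addr0.
  have Bv s : B s a *m v = 0 by rewrite BC; apply: Sv; exists a, s.
  apply: (scalerI two0); rewrite scalemxAl brBB a0 a1 !mulmxDl -!scalemxAl !Bv.
  by rewrite !mulr0 subrr !scale0r !scaler0 !addr0.
Qed.

Let LK k : K k -> L k = 0.
Proof.
move=> Kk.
apply: (ideal_eq0 (S := [set A | exists k, K k /\ A = L k])); last by exists k.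
- move=> _ [a [[a0 a1] ->]]; right; exists 1, (L u0).
  split; first exact: oner_neq0.
  by rewrite brLL p0u0 p1u0 a0 a1; mx_ring.
- move=> _ _ [a [[a0 a1] ->]] [c [[c0 c1] ->]].
  by rewrite brLL a0 a1 c0 c1; mx_ring.
- move=> v Sv _ _ [[u ->]|[u [u' ->]]] [a [Ka ->]]; have [a0 a1] := Ka.
    have -> : br (L u) (L a) = - r u *: L a by rewrite brLL a0 a1; mx_ring.
    by rewrite -scalemxAl Sv ?scaler0 //; exists a.
  rewrite brC brLB (BK u Ka) (BK u' Ka) a0 a1 subrr.
  by rewrite oppr0 scale0r !scaler0 !addr0 oppr0 mul0mx.
Qed.

Let p0Z a u : p0 (a *: u) = a * p0 u.
Proof.
have z : p0 0 = 0 by have := p0L (-1) 0 0; rewrite scaler0 addr0 mulN1r addNr.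
by have := p0L a u 0; rewrite z !addr0.
Qed.

Let p1Z a u : p1 (a *: u) = a * p1 u.
Proof.
have z : p1 0 = 0 by have := p1L (-1) 0 0; rewrite scaler0 addr0 mulN1r addNr.
by have := p1L a u 0; rewrite z !addr0.
Qed.

Let plane_linear (f : X -> 'M[C]_n.+1) u :
    (forall a u v, f (a *: u + v) = a *: f u + f v) ->
    (forall k, K k -> f k = 0) -> f u = p0 u *: f u0 + p1 u *: f u1.
Proof.
move=> fL fK.
have fZ a v : f (a *: v) = a *: f v.
  have z : f 0 = 0 by have := fL (-1) 0 0; rewrite scaler0 addr0 scaleN1r addNr.
  by have := fL a v 0; rewrite z !addr0.
have Ku : K (- 1 *: u + (p0 u *: u0 + p1 u *: u1)).
  by split; rewrite !(p0L, p1L, p0Z, p1Z) ?(p0u0, p1u0, p0u1, p1u1); ring.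
have := fK _ Ku; rewrite !fL fZ scaleN1r addrC => /eqP.
by rewrite subr_eq0 => /eqP ->.
Qed.

(* a lift of [rho], and the part of [L] that commutes with [B] *)
Let t := u0 + u1.
Let f u := L u - B u t.

Let fL a u v : f (a *: u + v) = a *: f u + f v.
Proof. by rewrite /f LL BL; mx_ring. Qed.

Let fK k : K k -> f k = 0.
Proof. by move=> Kk; rewrite /f LK // BK // subrr. Qed.

Let p0t : p0 t = 1.
Proof. by rewrite /t -[u0]scale1r p0L p0u0 p0u1 mulr1 addr0. Qed.

Let p1t : p1 t = 1.
Proof. by rewrite /t -[u0]scale1r p1L p1u0 p1u1 mulr0 add0r. Qed.

Let ft : f t = f u0 + f u1.
Proof. by rewrite (plane_linear t fL fK) p0t p1t !scale1r. Qed.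

Let BE u v : B u v = (p0 u * p0 v) *: B u0 u0 + (p0 u * p1 v + p1 u * p0 v) *: B u0 u1
   + (p1 u * p1 v) *: B u1 u1.
Proof.
rewrite (plane_linear (f := B^~ v) u); last 2 first.
- by move=> a x y; exact: BL.
- by move=> k; exact: BK.
rewrite ![B _ v]BC (plane_linear (f := B^~ u0) v); last 2 first.
- by move=> a x y; exact: BL.
- by move=> k; exact: BK.
rewrite (plane_linear (f := B^~ u1) v); last 2 first.
- by move=> a x y; exact: BL.
- by move=> k; exact: BK.
rewrite (BC u1 u0); mx_ring.
Qed.

(** Any three vectors of the plane satisfy the relation of Pluecker, and [B] depends
    on their images in the plane only. *)
Let brfB u v s : br (f u) (B v s) = 0.
Proof.
apply: (scalerI two0); rewrite scaler0 /f brBl scalerBr brBB brLB p0t p1t.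
rewrite (BE v s) (BE u s) (BE u v) (BE t s) (BE t v) p0t p1t; mx_ring.
Qed.

Let brff u v : br (f u) (f v) = - w u v *: e0%:M - r u *: f v + r v *: f u.
Proof.
rewrite {2}/f brBr brfB subr0 /f brBl brLL [br (B _ _) _]brC brLB p0t p1t /f.
rewrite (BC v u); mx_ring.
Qed.

(** The bracket of [f t - e0%:M] with [f v] is its product by [r v], so it is
    nilpotent and its kernel is stable. *)
Let fte : f t = e0%:M.
Proof.
apply/eqP; rewrite -subr_eq0; apply/eqP.
apply: (ideal_eq0 (S := [set f t - e0%:M])) => //.
- move=> _ ->; right; exists 1, (f u0); split; first exact: oner_neq0.
  rewrite brBr br_scalarr brff p0t p1t p0u0 p1u0; mx_ring.
- by move=> _ _ -> ->; rewrite brAA.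
- move=> v Sv _ _ [[u ->]|[u [u' ->]]] ->; last first.
    by rewrite brBr br_scalarr subr0 brC brfB oppr0 mul0mx.
  have -> : br (L u) (f t - e0%:M) = - r u *: (f t - e0%:M).
    have -> : L u = f u + B u t by rewrite /f subrK.
    rewrite brBr br_scalarr subr0 brDl brff [br (B _ _) _]brC brfB p0t p1t.
    mx_ring.
  by rewrite -scalemxAl Sv // scaler0.
Qed.

Let f_scalar u : exists c, f u = c%:M.
Proof.
apply: (schur_scalar irrO) => _ [[v ->]|[v [s ->]]]; last by rewrite brC brfB oppr0.
have -> : L v = f v + B v t by rewrite /f subrK.
rewrite brDl [br (B _ _) _]brC brfB oppr0 addr0 brff -fte ft.
rewrite (plane_linear u fL fK) (plane_linear v fL fK); mx_ring.
Qed.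

(** The matrices [e], [h] and [g] are the values of [B] on the standard basis of the
    plane, [a] and [b] the scalars [f u0] and [f u1]. *)
Lemma reduction_to_sl2 : exists (a b : C) (e h g : 'M[C]_n.+1),
  [/\ forall u, e0%:M + L u + B u u =
        ((p0 u + 1) * a + (p1 u + 1) * b)%:M
        + ((p0 u * (p0 u + 1)) *: e
           + (p0 u * (p1 u + 1) + p1 u * (p0 u + 1)) *: h
           + (p1 u * (p1 u + 1)) *: g),
      br e g = 2 *: h, br h e = - e, br h g = g &
      irreducible_family [set A | A = e \/ A = h \/ A = g]].
Proof.
have [a fa] := f_scalar u0; have [b fb] := f_scalar u1.
have LE u : L u = (p0 u * a + p1 u * b)%:M + B u t.
  have -> : L u = f u + B u t by rewrite /f subrK.
  congr (_ + _); rewrite (plane_linear u fL fK) fa fb.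
  by rewrite !scale_scalar_mx raddfD.
exists a, b, (B u0 u0), (B u0 u1), (B u1 u1); split.
- move=> u; rewrite LE (BE u t) (BE u u) p0t p1t -fte ft fa fb.
  move: (B u0 u0) (B u0 u1) (B u1 u1) => *; apply/matrixP => i j; rewrite !mxE.
  by case: (i == j); rewrite ?mulr1n ?mulr0n; ring.
- apply: (scalerI two0); rewrite brBB p0u0 p1u0 p0u1 p1u1; mx_ring.
- apply: (scalerI two0); rewrite brBB p0u0 p1u0 p0u1 p1u1 (BC u1); mx_ring.
- apply: (scalerI two0); rewrite brBB p0u0 p1u0 p0u1 p1u1; mx_ring.
- move=> P P0 PD PO [v v0 Pv]; apply: irrO => //; last by exists v.
  have PB u s x : P x -> P (B u s *m x).
    move=> Px; rewrite BE !mulmxDl -!scalemxAl -addrA.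
    apply: (PD _ _ _); first by apply: (PO _ _) => //; left.
    apply: (PD _ _ _); first by apply: (PO _ _) => //; right; left.
    rewrite -[_ *: _]addr0; apply: (PD _ _ _) => //; apply: (PO _ _) => //; by right; right.
  move=> A x [[u ->]|[u [s ->]]] Px; last exact: PB.
  rewrite LE mulmxDl mul_scalar_mx; apply: (PD _ _ _) => //; exact: PB.
Qed.

End Reduction.

(** * Irreducible modules of sl2 *)

Lemma ord2_cases (k : 'I_2) : k = 0 \/ k = 1.
Proof. by case: k => [[|[|//]] lti]; [left | right]; apply/val_inj. Qed.

Section HomogeneousCoefficients.
Variable K : numFieldType.
Implicit Types (q : {mpoly K[2]}) (i j : nat).

Definition mon i j : 'X_{1..2} := (U_(0%R) *+ i + U_(1%R) *+ j)%MM.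

Lemma mon0 i j : mon i j 0%R = i.
Proof. by rewrite mnmDE !mulmnE !mnm1E /= mul1n addn0. Qed.

Lemma mon1 i j : mon i j 1%R = j.
Proof. by rewrite mnmDE !mulmnE !mnm1E /= mul1n. Qed.

Lemma monE (m : 'X_{1..2}) : m = mon (m 0%R) (m 1%R).
Proof.
apply/mnmP => k; have [->|->] := ord2_cases k.
- by rewrite mon0.
- by rewrite mon1.
Qed.

Lemma monD i j k l : (mon i j + mon k l)%MM = mon (i + k) (j + l).
Proof. by rewrite [LHS]monE; congr mon; rewrite mnmDE ?mon0 ?mon1. Qed.

Lemma mon10 : U_(0%R)%MM = mon 1 0.
Proof. by rewrite [LHS]monE !mnm1E. Qed.

Lemma mon01 : U_(1%R)%MM = mon 0 1.
Proof. by rewrite [LHS]monE !mnm1E. Qed.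

Lemma mdeg_mon i j : mdeg (mon i j) = (i + j)%N.
Proof. by rewrite mdegD !mdegMn !mdeg1 !mul1n. Qed.

Lemma mcoeffXM_eq0 (k : 'I_2) q (m : 'X_{1..2}) : m k = 0%N -> ('X_k * q)@_m = 0.
Proof.
move=> mk; rewrite {1}[q]mpolyE mulr_sumr raddf_sum big1 // => l _ /=.
rewrite -scalerAr mcoeffZ -mpolyXD mcoeffX.
have /negPf -> : (U_(k) + l)%MM != m.
  by apply: contra_eq_neq mk => <-; rewrite mnmDE mnm1E eqxx.
by rewrite mulr0.
Qed.

Lemma mcoeff_X1_d0 i j q : ('X_1 * mderiv 0 q)@_(mon i j.+1) = q@_(mon i.+1 j) *+ i.+1.
Proof.
have -> : mon i j.+1 = (U_(1%R) + mon i j)%MM by rewrite mon01 monD.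
by rewrite mulrC mcoeffMX mcoeff_mderiv mon0 mon10 monD addn0 addn1.
Qed.

Lemma mcoeff_X0_d1 i j q : ('X_0 * mderiv 1 q)@_(mon i.+1 j) = q@_(mon i j.+1) *+ j.+1.
Proof.
have -> : mon i.+1 j = (U_(0%R) + mon i j)%MM by rewrite mon10 monD.
by rewrite mulrC mcoeffMX mcoeff_mderiv mon1 mon01 monD addn0 addn1.
Qed.

Lemma mcoeff_X1_d1 i j q : ('X_1 * mderiv 1 q)@_(mon i j) = q@_(mon i j) *+ j.
Proof.
case: j => [|j]; first by rewrite mcoeffXM_eq0 ?mon1.
have E : mon i j.+1 = (U_(1%R) + mon i j)%MM by rewrite mon01 monD.
by rewrite {1}E mulrC mcoeffMX mcoeff_mderiv mon1 addmC -E.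
Qed.

Lemma mcoeff_X0_d0 i j q : ('X_0 * mderiv 0 q)@_(mon i j) = q@_(mon i j) *+ i.
Proof.
case: i => [|i]; first by rewrite mcoeffXM_eq0 ?mon0.
have E : mon i.+1 j = (U_(0%R) + mon i j)%MM by rewrite mon10 monD.
by rewrite {1}E mulrC mcoeffMX mcoeff_mderiv mon0 addmC -E.
Qed.

Lemma dhomog_XM_mderiv m (k l : 'I_2) q :
  q \is m.-homog -> 'X_k * mderiv l q \is m.-homog.
Proof.
move=> hq; rewrite [q]mpolyE raddf_sum mulr_sumr big_seq rpred_sum // => u uq /=.
rewrite mderivZ mderivX -!scalerAr -mpolyXD.
have [->|ul] := posnP (u l); first by rewrite scale0r scaler0 rpred0.
rewrite !rpredZ // dhomogX /= mdegD mdeg1 add1n.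
have <- : mdeg u = m by have /dhomogP /(_ u uq) := hq.
by rewrite -{2}(submK (m := U_(l)) (m' := u)) ?lep1mP -?lt0n // mdegD mdeg1 addn1.
Qed.

End HomogeneousCoefficients.

Section SL2.
Variables (C : numClosedFieldType) (n : nat) (e h g : 'M[C]_n.+1).
Hypothesis breg : br e g = 2 *: h.
Hypothesis brhe : br h e = - e.
Hypothesis brhg : br h g = g.
Hypothesis irr : irreducible_family [set A | A = e \/ A = h \/ A = g].

(** Applying the nilpotent matrix [e] repeatedly to an eigenvector of [h] gives
    eigenvectors of [h]; the last nonzero one is killed by [e]. *)
Lemma highest_weight_vector : exists (c : C) (v : 'cV[C]_n.+1),
  [/\ v != 0, e *m v = 0 & h *m v = c *: v].
Proof.
have [c rc] : exists c, root (char_poly h^T) c.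
  by apply/closed_rootP; rewrite size_char_poly.
have := rc; rewrite -eigenvalue_root_char => /eigenvalueP [v vh v0].
have hv : h *m v^T = c *: v^T.
  by apply: trmx_inj; rewrite trmx_mul trmxK vh linearZ /= trmxK.
have he j : h *m (e ^+ j *m v^T) = (c - j%:R) *: (e ^+ j *m v^T).
  have := brX (c := -1) j (etrans brhe (esym (scaleN1r e))).
  move=> bj; rewrite br_mulmx bj hv -scalemxAr -scalemxAl -scalerDl.
  by congr (_ *: _); ring.
have [k ek] : exists k, e ^+ k *m v^T == 0.
  have [k ek] : exists k, e ^+ k = 0.
    by apply: (ad_eigenvector_nilpotent (A := h) (c := -1));
      rewrite ?oppr_eq0 ?oner_eq0 // scaleN1r.
  by exists k; rewrite ek mul0mx.
have [[|j] /eqP ej minj] := ex_minnP (ex_intro (fun k => e ^+ k *m v^T == 0) k ek).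
  by move: ej; rewrite expr0 mul1mx => /eqP; rewrite trmx_eq0 (negPf v0).
exists (c - j%:R), (e ^+ j *m v^T); split=> //.
  by apply/negP => /minj; rewrite ltnn.
by rewrite mulmxA -[e *m _]/(e * e ^+ j) -exprS.
Qed.

(** The vectors [v k] are obtained from a highest weight vector by powers of [- g].
    At the first index [m.+1] with [v m.+1 = 0], the formula for [e *m v m.+1]
    determines the highest weight. *)
Lemma weight_basis : exists (m : nat) (v : nat -> 'cV[C]_n.+1),
  [/\ v m != 0, v m.+1 = 0, forall k, g *m v k = - v k.+1,
      forall k, h *m v k = (k%:R - m%:R / 2) *: v k &
      e *m v 0 = 0 /\
      forall k, e *m v k.+1 = (k.+1%:R * (m%:R - k%:R)) *: v k].
Proof.
have [c [u [u0 eu hu]]] := highest_weight_vector.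
pose v k : 'cV[C]_n.+1 := iter k (fun x => - (g *m x)) u.
have gv k : g *m v k = - v k.+1 by rewrite /= opprK.
have hv k : h *m v k = (c + k%:R) *: v k.
  elim: k => [|k IH]; first by rewrite addr0.
  rewrite /= mulmxN br_mulmx IH brhg -scalemxAr scalerN.
  by congr (- _); rewrite -natr1 addrA [RHS]scalerDl scale1r.
have ev k : e *m v k.+1 = - (k.+1%:R * (2 * c + k%:R)) *: v k.
  elim: k => [|k IH].
    by rewrite /= mulmxN br_mulmx eu mulmx0 add0r breg -scalemxAl hu scalerA;
      rewrite -scaleNr; congr (_ *: _); ring.
  have -> : v k.+2 = - (g *m v k.+1) by [].
  rewrite mulmxN br_mulmx IH breg -scalemxAr gv -scalemxAl hv -!natr1.
  by move: (v k.+1) => x; mx_ring.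
have [k vk] : exists k, v k == 0.
  have [k gk] : exists k, g ^+ k = 0.
    by apply: (ad_eigenvector_nilpotent (A := h) (c := 1));
      rewrite ?oner_eq0 // scale1r.
  have vE j : v j = (-1) ^+ j *: (g ^+ j *m u).
    elim: j => [|j IH]; first by rewrite !expr0 scale1r mul1mx.
    rewrite /= IH -scalemxAr mulmxA -[g *m _]/(g * g ^+ j) -exprS.
    by rewrite [in RHS]exprS mulN1r scaleNr.
  by exists k; rewrite vE gk mul0mx scaler0.
have [[|m] /eqP vm minm] := ex_minnP (ex_intro (fun k => v k == 0) k vk).
  by move: u0; rewrite -[u]/(v 0%N) vm eqxx.
have vm0 : v m != 0 by apply/negP => /minm; rewrite ltnn.
have cE : 2 * c = - m%:R.
  have := ev m; rewrite vm mulmx0 => /esym/eqP; rewrite scaler_eq0 (negPf vm0) orbF.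
  by rewrite oppr_eq0 mulf_eq0 pnatr_eq0 /= addr_eq0 => /eqP.
have cE' : c = - (m%:R / 2).
  by rewrite -mulNr -cE mulrC mulKf // pnatr_eq0.
exists m, v; split=> // [j|]; first by rewrite hv cE' addrC.
by split=> [//|j]; rewrite ev cE; congr (_ *: _); ring.
Qed.

Section FromBasis.
Variables (m : nat) (v : nat -> 'cV[C]_n.+1).
Hypothesis vm : v m != 0.
Hypothesis vm1 : v m.+1 = 0.
Hypothesis gv : forall k, g *m v k = - v k.+1.
Hypothesis hv : forall k, h *m v k = (k%:R - m%:R / 2) *: v k.
Hypothesis ev0 : e *m v 0 = 0.
Hypothesis ev : forall k, e *m v k.+1 = (k.+1%:R * (m%:R - k%:R)) *: v k.

(** [v k] is [(- g) ^+ k *m v 0], and [- g] corresponds to ['X_1 * mderiv 0];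
    the factorial makes ['X_0 ^+ (m - k) * 'X_1 ^+ k] correspond to [v k]. *)
Definition sym_to_weight (q : {mpoly C[2]}) : 'cV[C]_n.+1 :=
  \sum_(k < m.+1) (q@_(mon (m - k) k) * (m - k)`!%:R) *: v k.

Lemma sym_to_weight_linear : linear sym_to_weight.
Proof.
move=> a p q; rewrite /sym_to_weight scaler_sumr -big_split /=.
by apply: eq_bigr => k _; rewrite mcoeffD mcoeffZ scalerA -scalerDl mulrDl mulrA.
Qed.

Lemma sym_to_weight_g q : sym_to_weight (- ('X_1 * mderiv 0 q)) = g *m sym_to_weight q.
Proof.
rewrite /sym_to_weight mulmx_sumr big_ord_recl [RHS]big_ord_recr /=.
rewrite mcoeffN mcoeffXM_eq0 ?mon1 // oppr0 mul0r scale0r add0r.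
rewrite -scalemxAr gv vm1 oppr0 scaler0 addr0; apply: eq_bigr => k _.
rewrite /bump /= add1n mcoeffN mcoeff_X1_d0 -scalemxAr gv mulNr scaleNr scalerN.
have -> : (m - k = (m - k.+1).+1)%N by rewrite -subSn ?subSS // ltn_ord.
by congr (- (_ *: _)); rewrite factS natrM -[X in X * _]mulr_natr -mulrA.
Qed.

Lemma sym_to_weight_e q : sym_to_weight ('X_0 * mderiv 1 q) = e *m sym_to_weight q.
Proof.
rewrite /sym_to_weight mulmx_sumr big_ord_recr [RHS]big_ord_recl /=.
rewrite mcoeffXM_eq0 ?mon0 ?subnn // mul0r scale0r addr0.
rewrite -scalemxAr ev0 scaler0 add0r; apply: eq_bigr => k _.
rewrite /bump /= add1n -scalemxAr ev scalerA.
have -> : (m - k = (m - k.+1).+1)%N by rewrite -subSn ?subSS // ltn_ord.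
rewrite mcoeff_X0_d1 factS natrM -[X in X * _]mulr_natr; congr (_ *: _).
rewrite (_ : m%:R - k%:R = (m - k.+1).+1%:R :> C); first by ring.
by rewrite -subSn ?subSS ?natrB // ltnW.
Qed.

Lemma sym_to_weight_h q :
  sym_to_weight (2^-1 *: ('X_1 * mderiv 1 q - 'X_0 * mderiv 0 q)) =
  h *m sym_to_weight q.
Proof.
rewrite /sym_to_weight mulmx_sumr; apply: eq_bigr => k _.
rewrite mcoeffZ mcoeffB mcoeff_X1_d1 mcoeff_X0_d0 -scalemxAr hv scalerA.
congr (_ *: _).
rewrite -[q@__ *+ k]mulr_natr -[q@__ *+ (m - k)]mulr_natr natrB -1?ltnS //.
by field.
Qed.

(** Applying [g] to a linear relation [m - k] times leaves its term of index [k],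
    once the coefficients of smaller index are known to vanish. *)
Lemma weight_basis_free (c : nat -> C) :
  \sum_(k < m.+1) c k *: v k = 0 -> forall k, (k <= m)%N -> c k = 0.
Proof.
have vanish k : (m < k)%N -> v k = 0.
  move=> /subnK <-; elim: (k - m.+1)%N => [//|j IH].
  by apply/eqP; rewrite -oppr_eq0 addSn -gv IH mulmx0.
have shift d : \sum_(k < m.+1) c k *: v k = 0 -> \sum_(k < m.+1) c k *: v (d + k)%N = 0.
  move=> c0; elim: d => [//|d IH].
  apply/eqP; rewrite -oppr_eq0 -sumrN; apply/eqP.
  rewrite -[RHS](mulmx0 _ g) -[in RHS]IH mulmx_sumr; apply: eq_bigr => k _.
  by rewrite -scalemxAr gv scalerN addSn.
move=> c0; elim/ltn_ind => k IH km.
have := shift (m - k)%N c0; rewrite (bigD1 (Ordinal (km : (k < m.+1)%N))) //= subnK //.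
rewrite big1 => [|i ik].
  by rewrite addr0 => /eqP; rewrite scaler_eq0 (negPf vm) orbF => /eqP.
have [ik'|ik'] := ltnP i k; first by rewrite IH ?scale0r // -ltnS.
rewrite vanish ?scaler0 // -{1}(subnK km) ltn_add2l.
rewrite ltn_neqAle ik' andbT; apply: contraNneq ik => E.
by apply/eqP/val_inj.
Qed.

Lemma sym_to_weight_inj q :
  q \is m.-homog -> sym_to_weight q = 0 -> q = 0.
Proof.
move=> hq q0; apply/mpolyP => mm; rewrite mcoeff0.
have [dm|dm] := eqVneq (mdeg mm) m; last exact: (dhomog_nemf_coeff hq).
rewrite (monE mm); have := dm; rewrite {1}(monE mm) mdeg_mon => dE.
have := weight_basis_free (c := fun k => q@_(mon (m - k) k) * (m - k)`!%:R) q0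
  (k := mm 1%R).
rewrite -dE leq_addl addnK => /(_ isT)/eqP.
by rewrite mulf_eq0 pnatr_eq0 (gtn_eqF (fact_gt0 _)) orbF => /eqP.
Qed.

(** The image of [S^m] is nonzero and stable. *)
Lemma sym_to_weight_surj u :
  exists2 q, q \is m.-homog & sym_to_weight q = u.
Proof.
have D x y a b : x \is m.-homog -> y \is m.-homog ->
    sym_to_weight x = a -> sym_to_weight y = b ->
    forall c, exists2 q, q \is m.-homog & sym_to_weight q = c *: a + b.
  move=> hx hy <- <- c; exists (c *: x + y); first by rewrite rpredD ?rpredZ.
  by rewrite sym_to_weight_linear.
have homM := @dhomog_XM_mderiv C m.
apply: (irr (P := fun u => exists2 q, q \is m.-homog & sym_to_weight q = u)).
- exists 0; first exact: rpred0.
  by rewrite /sym_to_weight big1 // => k _; rewrite mcoeff0 mul0r scale0r.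
- by move=> a _ _ [x hx <-] [y hy <-]; apply: D hx hy _ _ a.
- move=> A _ [->|[->|->]] [q hq <-].
  + by exists ('X_0 * mderiv 1 q); [exact: homM | exact: sym_to_weight_e].
  + exists (2^-1 *: ('X_1 * mderiv 1 q - 'X_0 * mderiv 0 q)).
      by rewrite rpredZ // rpredB //; exact: homM.
    exact: sym_to_weight_h.
  + exists (- ('X_1 * mderiv 0 q)); last exact: sym_to_weight_g.
    by rewrite rpredN; exact: homM.
- exists (v m) => //; exists 'X_[mon 0 m]; first by rewrite dhomogX /= mdeg_mon.
  rewrite /sym_to_weight big_ord_recr /= subnn mcoeffX eqxx mulr1 scale1r.
  rewrite big1 ?add0r // => k _; rewrite mcoeffX.
  have /negPf -> : mon 0 m != mon (m - k) k.
    apply/negP => /eqP /(congr1 (fun x : 'X_{1..2} => x 1%R)).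
    by rewrite !mon1 => mk; have := ltn_ord k; rewrite -mk ltnn.
  by rewrite mul0r scale0r.
Qed.

End FromBasis.

(** The operators on polynomials that correspond to [e], [h] and [g] are half the
    Poisson brackets with ['X_0 ^+ 2], ['X_0 * 'X_1] and ['X_1 ^+ 2]. *)
Lemma sl2_irreducible_sym : exists (m : nat) (phi : {mpoly C[2]} -> 'cV[C]_n.+1),
  [/\ linear phi,
      forall q, phi ('X_0 * mderiv 1 q) = e *m phi q,
      forall q, phi (2^-1 *: ('X_1 * mderiv 1 q - 'X_0 * mderiv 0 q)) = h *m phi q,
      forall q, phi (- ('X_1 * mderiv 0 q)) = g *m phi q &
      (forall q, q \is m.-homog -> phi q = 0 -> q = 0) /\
      (forall u, exists2 q, q \is m.-homog & phi q = u)].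
Proof.
have [m [v [vm vm1 gv hv [ev0 ev]]]] := weight_basis.
exists m, (sym_to_weight m v); split.
- exact: sym_to_weight_linear.
- exact: sym_to_weight_e.
- exact: sym_to_weight_h.
- exact: sym_to_weight_g.
- by split; [exact: sym_to_weight_inj | exact: sym_to_weight_surj].
Qed.

End SL2.

(** * Linear algebra of weight spaces *)

Section FiniteBasis.
Variables (C : numClosedFieldType) (T : lmodType C).

(** Applying [D - la i] removes one term of the relation and multiplies the others
    by nonzero scalars. *)
Lemma eigenvectors_free (I : eqType) (D : T -> T) (la : I -> C) (v : I -> T)
    (s : seq I) :
    (forall a x y, D (a *: x + y) = a *: D x + D y) -> injective la ->
    (forall i, D (v i) = la i *: v i) -> uniq s ->
  \sum_(i <- s) v i = 0 -> forall i, i \in s -> v i = 0.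
Proof.
move=> DL la_inj.
have D0 : D 0 = 0 by have := DL (-1) 0 0; rewrite scaler0 addr0 scaleN1r addNr.
elim: s v => [//|i s IH] v Dv /andP [ins us]; rewrite big_cons => vs.
have {}Dv' : forall k, D ((la k - la i) *: v k) = la k *: ((la k - la i) *: v k).
  move=> k; have := DL (la k - la i) (v k) 0; rewrite !addr0 D0 addr0 => ->.
  by rewrite Dv !scalerA mulrC.
have z : \sum_(k <- s) (la k - la i) *: v k = 0.
  have sE : \sum_(k <- s) v k = - v i.
    by apply/eqP; rewrite -addr_eq0 addrC vs.
  have Ds : D (\sum_(k <- s) v k) = \sum_(k <- s) la k *: v k.
    elim: (s) => [|k t IHt]; first by rewrite !big_nil D0.
    by rewrite !big_cons -[v k]scale1r DL IHt Dv !scale1r.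
  under eq_bigr do rewrite scalerBl.
  rewrite sumrB -scaler_sumr -Ds sE scalerN -scaleN1r.
  by have := DL (-1) (v i) 0; rewrite !addr0 D0 addr0 => ->; rewrite Dv scaleN1r subrr.
have vs0 k : k \in s -> v k = 0.
  move=> ks; have /eqP := IH _ Dv' us z k ks.
  rewrite scaler_eq0 subr_eq0 => /orP [/eqP /la_inj ki|/eqP //].
  by rewrite -ki ks in ins.
move=> k; rewrite inE => /predU1P [->|/vs0 //].
by move: vs; rewrite big_seq big1 ?addr0.
Qed.

(** A spanning family of minimal length is a basis. *)
Lemma finite_basis (U : set T) :
    (forall a u v, U u -> U v -> U (a *: u + v)) ->
    (exists2 u, u != 0 & U u) ->
    (exists (k : nat) (e : 'I_k -> T), (forall i, U (e i)) /\
      forall v, U v -> exists c : 'I_k -> C, v = \sum_i c i *: e i) ->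
  exists (n : nat) (iota : {linear 'cV[C]_n.+1 -> T}),
    [/\ forall c, U (iota c), forall c, iota c = 0 -> c = 0 &
        forall v, U v -> exists c, v = iota c].
Proof.
move=> UL [u u0 Uu] exk.
have U0 : U 0 by have := UL (-1) u u Uu Uu; rewrite scaleN1r addNr.
pose P k := `[< exists e : 'I_k -> T, (forall i, U (e i)) /\
      forall v, U v -> exists c : 'I_k -> C, v = \sum_i c i *: e i >].
have exP : exists k, P k.
  by have [k [e He]] := exk; exists k; apply/asboolP; exists e.
have [k /asboolP [e [Ue eU]] mink] := ex_minnP exP.
case: k e Ue eU mink => [|n] e Ue eU mink.
  by have [c] := eU u Uu; rewrite big_ord0 => uE; rewrite uE eqxx in u0.
pose f (c : 'cV[C]_n.+1) := \sum_i c i 0 *: e i.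
have fL : linear f.
  move=> a c d; rewrite /f scaler_sumr -big_split /=.
  by apply: eq_bigr => i _; rewrite !mxE scalerDl scalerA.
pose iota : {linear 'cV[C]_n.+1 -> T} := HB.pack f (GRing.isLinear.Build _ _ _ _ f fL).
exists n, iota; split=> [c|c c0|v Uv].
- rewrite /= /f; elim: (index_enum _) => [|i s IH]; first by rewrite big_nil.
  by rewrite big_cons; exact: UL.
- apply/eqP; apply: contraT => /matrix0Pn [j [j0]]; rewrite (ord1 j0) => cj.
  have ejE : e j = - \sum_(i < n) (c (lift j i) 0 / c j 0) *: e (lift j i).
    move: c0; rewrite /= /f (bigD1_ord j) //= => /eqP; rewrite addr_eq0 => /eqP cE.
    apply: (scalerI cj); rewrite cE scalerN scaler_sumr; congr (- _).
    by apply: eq_bigr => i _; rewrite scalerA mulrC divfK.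
  suff /mink : P n by rewrite ltnn.
  apply/asboolP; exists (fun i => e (lift j i)); split=> // v Uv.
  have [d ->] := eU v Uv.
  exists (fun i => d (lift j i) - d j * (c (lift j i) 0 / c j 0)).
  rewrite (bigD1_ord j) //= {1}ejE scalerN scaler_sumr -sumrN -big_split /=.
  by apply: eq_bigr => i _; rewrite scalerBl scalerA addrC.
- have [c ->] := eU v Uv; exists (\col_i c i).
  by rewrite /= /f; apply: eq_bigr => i _; rewrite mxE.
Qed.

Lemma operator_matrix n (iota : {linear 'cV[C]_n.+1 -> T}) (F : T -> T) :
    (forall a x y, F (a *: x + y) = a *: F x + F y) ->
    (forall c, exists d, F (iota c) = iota d) ->
  exists M : 'M[C]_n.+1, forall c, F (iota c) = iota (M *m c).
Proof.
move=> FL FI.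
have F0 : F 0 = 0 by have := FL (-1) 0 0; rewrite scaler0 addr0 scaleN1r addNr.
have [d Fd] := choice (fun j : 'I_n.+1 => FI (delta_mx j 0)).
exists (\matrix_(i, j) d j i 0) => c.
have cE : c = \sum_j c j 0 *: delta_mx j 0.
  by rewrite {1}[c]matrix_sum_delta; apply: eq_bigr => i _; rewrite big_ord1.
rewrite {1}cE (_ : _ *m c = \sum_j c j 0 *: d j); last first.
  apply/colP => i; rewrite !mxE summxE; apply: eq_bigr => j _.
  by rewrite !mxE mulrC.
rewrite [in RHS]raddf_sum raddf_sum /=.
elim: (index_enum _) => [|j s IH]; first by rewrite !big_nil.
by rewrite !big_cons !linearZ /= FL IH Fd.
Qed.

Section OperatorMatrices.
Variables (n : nat) (iota : {linear 'cV[C]_n.+1 -> T}).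
Hypothesis iota_inj : forall c, iota c = 0 -> c = 0.

Lemma operator_matrix_inj (A B : 'M[C]_n.+1) :
  (forall c, iota (A *m c) = iota (B *m c)) -> A = B.
Proof.
move=> AB; apply/matrixP => i j.
have /eqP := AB (delta_mx j 0); rewrite -subr_eq0 -raddfB => /eqP /iota_inj.
move/eqP; rewrite subr_eq0 -!colE => /eqP /colP /(_ i).
by rewrite !mxE.
Qed.

Lemma operator_matrix_br (F1 F2 F3 : T -> T) (M1 M2 M3 : 'M[C]_n.+1) (a b c : C) :
    (forall d, F1 (iota d) = iota (M1 *m d)) ->
    (forall d, F2 (iota d) = iota (M2 *m d)) ->
    (forall d, F3 (iota d) = iota (M3 *m d)) ->
    (forall d, F1 (F2 (iota d)) - F2 (F1 (iota d)) =
       a *: F3 (iota d) - b *: F2 (iota d) + c *: F1 (iota d)) ->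
  br M1 M2 = a *: M3 - b *: M2 + c *: M1.
Proof.
move=> FM1 FM2 FM3 Fbr; apply: operator_matrix_inj => d; rewrite unlock.
rewrite mulmxBl !mulmxDl mulNmx -!mulmxA -!scalemxAl.
rewrite !raddfD !raddfN.
have := Fbr d; rewrite FM2 FM1 FM1 FM2 FM3 => e; apply: etrans e _.
by congr (_ - _ + _); apply/esym; exact: linearZZ.
Qed.

Lemma operator_matrix_scalar (F : T -> T) (M : 'M[C]_n.+1) (a : C) :
    (forall d, F (iota d) = iota (M *m d)) ->
    (forall d, F (iota d) = a *: iota d) -> M = a%:M.
Proof.
move=> FM Fa; apply: operator_matrix_inj => d.
by rewrite -FM Fa mul_scalar_mx; apply/esym; exact: linearZZ.
Qed.

End OperatorMatrices.

End FiniteBasis.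

(** * Graded modules *)

Section GradedModule.
Variables (R : realType) (N : nat) (pi : {additive 'rV[int]_N -> plane R}).
Local Notation C := R[i].
Local Notation G := 'rV[int]_N.
Variable T : avModule pi.
Implicit Types (x y z : G) (v : T).

Definition lat_symp x y : C := symp (pi x) (pi y).
Definition lat_rho x : C := symp rho (pi x).

Lemma lat_sympC x y : lat_symp x y = - lat_symp y x.
Proof. exact: sympC. Qed.

Lemma lat_rhoD x y : lat_rho (x + y) = lat_rho x + lat_rho y.
Proof. by rewrite /lat_rho raddfD sympDr. Qed.

Lemma symp_shiftl x y : symp (pi x + rho) (pi y) = lat_symp x y + lat_rho y.
Proof. exact: sympDl. Qed.

Lemma symp_shift x y :
  symp (pi x + rho) (pi y + rho) = lat_symp x y + lat_rho y - lat_rho x.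
Proof.
rewrite sympDr symp_shiftl sympDl /lat_rho [symp (pi x) rho]sympC.
by rewrite (_ : symp rho rho = 0) ?addr0 // /symp mulrC subrr.
Qed.

Definition Aop x v : T := actA (LA pi x) v.
Definition Vop x v : T := actV (LW pi x) v.

Lemma Aop_linear x : linear (Aop x). Proof. exact: actA_linearr. Qed.
Lemma Vop_linear x : linear (Vop x). Proof. exact: actV_linearr. Qed.

Lemma Aop0 v : Aop 0 v = v. Proof. exact: actA1. Qed.

Lemma AopD x y v : Aop (x + y) v = Aop x (Aop y v).
Proof.
rewrite /Aop -actAM; congr (actA _ v); rewrite /Defs.mulA bext_single.
apply: dsingle_eq; last by rewrite scale1r.
by rewrite raddfD -[RHS]addrA subrK addrAC.
Qed.

Lemma AopK x : cancel (Aop x) (Aop (- x)).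
Proof. by move=> v; rewrite -AopD addNr Aop0. Qed.

Lemma AopKV x : cancel (Aop (- x)) (Aop x).
Proof. by move=> v; rewrite -AopD subrr Aop0. Qed.

Lemma actZ_dsingle (S : set (plane R)) mu mu' (Smu : S mu) (Smu' : S mu')
    (a : C) : mu = mu' -> dsingle Smu (a : C^o) = a *: dsingle Smu' (1 : C^o).
Proof. by move=> E; rewrite dsingleZ; apply: dsingle_eq; rewrite ?[RHS]mulr1. Qed.

Lemma actAZ a u v : actA (a *: u) v = a *: actA u v :> T.
Proof.
have := actA_linearl v a u 0; rewrite (linear_0 (actA_linearl v)) !addr0; exact.
Qed.

Lemma actVZ a u v : actV (a *: u) v = a *: actV u v :> T.
Proof.
have := actV_linearl v a u 0; rewrite (linear_0 (actV_linearl v)) !addr0; exact.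
Qed.

Lemma VopA x y v : Vop x (Aop y v) =
  (lat_symp x y + lat_rho y) *: Aop (x + y) v + Aop y (Vop x v).
Proof.
rewrite /Vop /Aop actVA; congr (_ + _); rewrite /brWA bext_single.
rewrite -symp_shiftl -actAZ; congr (actA _ v).
rewrite /LA dsingleZ; apply: dsingle_eq; first by rewrite raddfD addrA.
by rewrite scale1r /br_coef /= subrK.
Qed.

Lemma Vop_br x y v : Vop x (Vop y v) - Vop y (Vop x v) =
  (lat_symp x y + lat_rho y - lat_rho x) *: Vop (x + y) v.
Proof.
rewrite /Vop -actVbr -symp_shift -actVZ; congr (actV _ v).
rewrite /brW bext_single dsingleZ; apply: dsingle_eq; first by rewrite raddfD.
by rewrite scale1r.
Qed.

(** The action of [LW x] moves the weights by [pi x]; undoing this translation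
    leaves an operator that preserves the weight spaces. *)
Definition Oop x v : T := Aop (- x) (Vop x v).

Lemma VopE x v : Vop x v = Aop x (Oop x v).
Proof. by rewrite /Oop AopKV. Qed.

Lemma AopZ x a v : Aop x (a *: v) = a *: Aop x v.
Proof.
by have := Aop_linear x a v 0; rewrite (linear_0 (Aop_linear x)) !addr0.
Qed.

Lemma Oop_linear x a u v : Oop x (a *: u + v) = a *: Oop x u + Oop x v.
Proof. by rewrite /Oop Vop_linear Aop_linear. Qed.

Lemma VopAE x y v : Vop x (Aop y v) =
  Aop (x + y) ((lat_symp x y + lat_rho y) *: v + Oop x v).
Proof.
by rewrite VopA VopE -AopD (linear_D _ _ (Aop_linear _)) AopZ [y + x]addrC.
Qed.

Lemma AopB x u v : Aop x (u - v) = Aop x u - Aop x v.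
Proof. by rewrite -scaleN1r addrC Aop_linear scaleN1r addrC. Qed.

Lemma Oop_br x y v : Oop x (Oop y v) - Oop y (Oop x v) =
  (lat_symp x y + lat_rho y - lat_rho x) *: Oop (x + y) v
  - (lat_symp x y + lat_rho y) *: Oop y v
  + (lat_rho x - lat_symp x y) *: Oop x v.
Proof.
have := Vop_br x y v; rewrite (VopE y v) (VopE x v) !VopAE (VopE (x + y)).
rewrite [y + x]addrC [lat_symp y x]lat_sympC -AopB -(AopZ (x + y)).
have inj z : injective (Aop z) := can_inj (AopK z).
move=> /inj <-; rewrite [- _ + lat_rho x]addrC.
move: (_ *: Oop y v) (_ *: Oop x v) (Oop x (Oop y v)) (Oop y (Oop x v)) => a b c d.
rewrite -[RHS]addrA [- a + b]addrC [- (b + d)]opprD [a + c + _]addrACA.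
by rewrite -[b - a]opprB [RHS]addrC addKr.
Qed.

Hypothesis pi_inj : injective pi.
Hypothesis rho_neq0 : forall x, x != 0 -> lat_rho x != 0.
Variable ga : plane R.
Hypothesis Tga : graded_by T ga.
Local Notation U := (weight_space (T := T) ga).

Lemma weight_spaceL mu a u v :
  weight_space mu u -> weight_space mu v -> weight_space (T := T) mu (a *: u + v).
Proof.
move=> Uu Uv; rewrite /weight_space /= (actV_linearr _ a u v) Uu Uv.
by rewrite scalerDr !scalerA mulrC.
Qed.

Lemma Aop_weight x mu v : weight_space mu v -> weight_space (mu + pi x) (Aop x v).
Proof.
move=> Uv; have := VopA 0 x v; rewrite /Vop Uv AopZ add0r => E.
rewrite /weight_space /= E -scalerDl /lat_symp raddf0; congr (_ *: _).
by rewrite /symp /lat_rho /symp !mxE; ring.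
Qed.

Lemma Oop_weight x v : U v -> U (Oop x v).
Proof.
move=> Uv; have := Oop_br 0 x v.
have O0 u : Oop 0 u = actV (LW pi 0) u by rewrite /Oop oppr0 Aop0.
have e : lat_symp 0 x = 0 by rewrite /lat_symp /symp raddf0 !mxE; ring.
have e' : lat_rho 0 = 0 by rewrite /lat_rho /symp raddf0 !mxE; ring.
rewrite e e' !add0r subr0 subrr oppr0 scale0r addr0 !O0 Uv => /eqP.
rewrite subr_eq0 /weight_space /= => /eqP ->.
have OL : linear (Oop x) by exact: Oop_linear.
by have := OL (symp rho ga) v 0; rewrite (linear_0 OL) !addr0.
Qed.

Lemma Oop0_weight v : U v -> Oop 0 v = symp rho ga *: v.
Proof. by move=> Uv; rewrite /Oop oppr0 Aop0. Qed.

(** The weight spaces are the translates [Aop x] of one of them. A linear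
    isomorphism [j] from [V0] to that one therefore identifies [T] with the space
    of functions of finite support with values in [V0]; the coset that indexes
    these functions is arbitrary. *)
Section Translates.
Variables (V0 : lmodType C) (j : {linear V0 -> T}) (ga' : plane R).
Hypothesis jU : forall u, U (j u).
Hypothesis j_inj : forall u, j u = 0 -> u = 0.
Hypothesis j_surj : forall v, U v -> exists u, v = j u.
Local Notation X := (dsum (coset pi ga') V0).

Lemma coset_translate x : coset pi ga' (ga' + pi x).
Proof. by rewrite /coset /= addrAC subrr add0r; exists x. Qed.

Definition translates (f : X) : T :=
  \sum_(x \in [set: G]) Aop x (j (f (ga' + pi x))).

Lemma translates_finsupp (f : X) :
  exists S : {fset G}, forall x, x \notin S -> f (ga' + pi x) = 0.
Proof.
have [A fA] := Defs.finsupp_sub f.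
have [px pxE] : exists px : plane R -> G, forall x, px (ga' + pi x) = x.
  have : forall mu, exists x, forall y, mu = ga' + pi y -> x = y.
    move=> mu; have [[x ->]|no] := pselect (exists x, mu = ga' + pi x).
      by exists x => y /addrI /pi_inj.
    by exists 0 => y E; case: no; exists y.
  by move/choice => [px Hpx]; exists px => x; exact: Hpx.
exists [fset px mu | mu in A]%fset => x xS; apply: fA; apply: contra xS => xA.
by apply/imfsetP; exists (ga' + pi x).
Qed.

Lemma translatesE (f : X) (S : {fset G}) :
    (forall x, x \notin S -> f (ga' + pi x) = 0) ->
  translates f = \sum_(x <- S) Aop x (j (f (ga' + pi x))).
Proof.
move=> fS; apply: fsbigTE => x /fS ->.
by rewrite linear0 (linear_0 (Aop_linear x)).
Qed.

Lemma translates_linear : linear translates.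
Proof.
move=> a f g; have [A fA] := translates_finsupp f.
have [B gB] := translates_finsupp g.
have fAB x : x \notin (A `|` B)%fset -> f (ga' + pi x) = 0.
  by rewrite inE negb_or => /andP [/fA].
have gAB x : x \notin (A `|` B)%fset -> g (ga' + pi x) = 0.
  by rewrite inE negb_or => /andP [_ /gB].
rewrite (translatesE fAB) (translatesE gAB) (@translatesE _ (A `|` B)%fset).
  rewrite scaler_sumr -big_split /=; apply: eq_bigr => x _.
  by rewrite /= !fctE linearP (Aop_linear x).
by move=> x xAB; rewrite /= !fctE fAB // gAB // scaler0 addr0.
Qed.

Lemma translates_single x (Gx : coset pi ga' (ga' + pi x)) u :
  translates (dsingle Gx u) = Aop x (j u).
Proof.
rewrite (@translatesE _ [fset x]%fset) => [|y].
  by rewrite big_seq_fset1 /= /delta eqxx.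
rewrite inE /= /delta => /negPf xy; case: eqP => // /addrI /pi_inj E.
by rewrite E eqxx in xy.
Qed.

(** The translates have distinct weights. *)
Lemma translates_inj (f : X) : translates f = 0 -> f = 0.
Proof.
have [S fS] := translates_finsupp f; rewrite (translatesE fS) => z.
have f0 x : f (ga' + pi x) = 0.
  have [xS|/fS //] := boolP (x \in S).
  have := @eigenvectors_free C T G (Vop 0) (fun x => symp rho (ga + pi x))
    (fun x => Aop x (j (f (ga' + pi x)))) S (Vop_linear 0) _ _ (fset_uniq S) z x xS.
  move=> H; apply: j_inj; rewrite -(AopK x (j _)) H ?(linear_0 (Aop_linear _)) //.
    move=> y y'; rewrite /= !sympDr => /addrI E.
    apply/eqP; rewrite -subr_eq0; apply: contraT => /rho_neq0.
    have : lat_rho (y - y') + lat_rho y' = 0 + lat_rho y'.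
      by rewrite -lat_rhoD subrK add0r.
    by move=> /addIr ->; rewrite eqxx.
  by move=> y; exact: Aop_weight.
apply: dsumP => mu; have [[x ->]|no] := pselect (exists x, mu = ga' + pi x).
  by rewrite f0.
apply/eqP; apply: contraT => fmu.
have [_ fG] := dsum_predP _ _ (dvalP f).
have [x _ E] := fG _ fmu; case: no; exists x.
by rewrite E addrC subrK.
Qed.

Lemma translates_surj v : exists f, translates f = v.
Proof.
pose P u := exists f, translates f = u.
have P0 : P 0 by exists 0; exact: (linear_0 translates_linear).
have PD u u' : P u -> P u' -> P (u + u').
  by move=> [f <-] [g <-]; exists (f + g); exact: (linear_D _ _ translates_linear).
have [c [[/finite_fsetP [A cA] cG cU ->] _]] := Tga v.
rewrite (@fsbigTE _ _ _ _ A) => [|mu]; last first.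
  apply: contraNeq => c0; by have : [set` A] mu by rewrite -cA.
elim: (A : seq _) => [|mu s IH]; first by rewrite big_nil.
rewrite big_cons; apply: PD => //.
have [->//|c0] := eqVneq (c mu) 0.
have [x _ xE] := cG mu c0.
have : U (Aop (- x) (c mu)).
  have := Aop_weight (- x) (cU mu); rewrite raddfN /= xE opprB addrC subrK; exact.
move=> /j_surj [u uE]; exists (dsingle (coset_translate x) u).
by rewrite translates_single -uE AopKV.
Qed.

End Translates.

End GradedModule.

(** * The fibre of a simple graded module *)

Section Fibre.
Variables (R : realType) (N : nat) (pi : {additive 'rV[int]_N -> plane R}).
Local Notation C := R[i].
Local Notation G := 'rV[int]_N.
Variable T : avModule pi.
Implicit Types x y z : G.
Hypothesis pi_inj : injective pi.
Hypothesis rho_neq0 : forall x, x != 0 -> lat_rho pi x != 0.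
Variable ga : plane R.
Hypothesis Tga : graded_by T ga.
Hypothesis Tfin : finite_rank T ga.
Hypothesis Tsimple : av_simple T.
Local Notation U := (weight_space (T := T) ga).

Lemma fibre_neq0 : exists2 u, u != 0 & U u.
Proof.
have [[v v0] _] := Tsimple; apply: contrapT => no.
have [c [[cfin cG cU vE] _]] := Tga v.
suff : v = 0 by move/eqP; rewrite (negPf v0).
rewrite vE (@fsbigTE _ _ _ _ fset0) => [|mu _]; first by rewrite big_seq_fset0.
apply/eqP; apply: contraT => c0; have [x _ xE] := cG mu c0; case: no.
exists (Aop (- x) (c mu)).
  apply: contraNneq c0 => E.
  by rewrite -(AopKV x (c mu)) E (linear_0 (Aop_linear x)).
have := Aop_weight (- x) (cU mu); rewrite raddfN /= xE opprB addrC subrK; exact.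
Qed.

Lemma fibre_basis : exists (n : nat) (iota : {linear 'cV[C]_n.+1 -> T}),
    [/\ forall c, U (iota c), forall c, iota c = 0 -> c = 0 &
        forall v, U v -> exists c, v = iota c].
Proof.
apply: finite_basis; first exact: weight_spaceL.
  exact: fibre_neq0.
have ga_coset : coset pi ga ga by rewrite /coset /= subrr; exists 0; rewrite ?raddf0.
by have [k [e [eU eS]]] := Tfin ga_coset; exists k, e.
Qed.

Variables (n : nat) (iota : {linear 'cV[C]_n.+1 -> T}).
Hypothesis iotaU : forall c, U (iota c).
Hypothesis iota_inj : forall c, iota c = 0 -> c = 0.
Variable E : G -> 'M[C]_n.+1.
Hypothesis EO : forall x c, Oop x (iota c) = iota (E x *m c).

Lemma fibre_br x y : br (E x) (E y) =
  (lat_symp pi x y + lat_rho pi y - lat_rho pi x) *: E (x + y)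
  - (lat_symp pi x y + lat_rho pi y) *: E y
  + (lat_rho pi x - lat_symp pi x y) *: E x.
Proof.
by apply: (operator_matrix_br iota_inj (EO x) (EO y) (EO (x + y))) => d; exact: Oop_br.
Qed.

Lemma fibre0 : E 0 = (symp rho ga)%:M.
Proof.
by apply: (operator_matrix_scalar iota_inj (EO 0)) => d; exact: Oop0_weight.
Qed.

Section GeneratedSubmodule.
Variable P : set 'cV[C]_n.+1.
Hypothesis PL : forall a u v, P u -> P v -> P (a *: u + v).
Hypothesis PE : forall x c, P c -> P (E x *m c).

Definition linear_subspace (W : set T) :=
  W 0 /\ forall (a : C) u v, W u -> W v -> W (a *: u + v).

(** The span of the translates of [P] is an intersection of subspaces: its
    stability under an operator is then shown by taking a preimage. *)
Definition generated : set T := [set v | forall W, linear_subspace W ->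
  (forall x c, P c -> W (Aop x (iota c))) -> W v].

Lemma generatedL (a : C) u v : generated u -> generated v -> generated (a *: u + v).
Proof.
move=> Ju Jv W WL WP; have [_ WD] := WL.
by apply: WD; [exact: Ju | exact: Jv].
Qed.

Lemma generated0 : generated 0. Proof. by move=> W [W0 _]. Qed.

Lemma generated_single x c : P c -> generated (Aop x (iota c)).
Proof. by move=> Pc W _; exact. Qed.

Lemma generated_preimage (F : T -> T) : linear F ->
    (forall x c, P c -> generated (F (Aop x (iota c)))) ->
  forall v, generated v -> generated (F v).
Proof.
move=> FL FP v Jv; apply: (Jv [set v | generated (F v)]) => //.
split=> /= [|a u u' Ju Ju']; first by rewrite linear_0 //; exact: generated0.
by rewrite FL; exact: generatedL.
Qed.

Lemma generated_submodule : av_submodule generated.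
Proof.
split=> [|a u v|a u Ju|a u Ju].
- exact: generated0.
- exact: generatedL.
- elim/dsum_ind: a => [|a b Ja Jb|la Gla a].
  + by rewrite (linear_0 (actA_linearl u)); exact: generated0.
  + rewrite (linear_D _ _ (actA_linearl u)) -[actA a u]scale1r.
    exact: generatedL.
  + have [y _ yE] := Gla.
    rewrite (actZ_dsingle _ (coset_shift pi y)); last by rewrite yE opprK addrK.
    rewrite actAZ -[_ *: _]addr0; apply: generatedL; last exact: generated0.
    apply: (generated_preimage (Aop_linear y)) => // x c Pc.
    by rewrite -AopD; exact: generated_single.
- elim/dsum_ind: a => [|a b Ja Jb|la Gla a].
  + by rewrite (linear_0 (actV_linearl u)); exact: generated0.
  + rewrite (linear_D _ _ (actV_linearl u)) -[actV a u]scale1r.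
    exact: generatedL.
  + have [y _ yE] := Gla.
    rewrite (actZ_dsingle _ (in_lattice_pi pi y)); last by rewrite yE.
    rewrite actVZ -[_ *: _]addr0; apply: generatedL; last exact: generated0.
    apply: (generated_preimage (Vop_linear y)) => // x c Pc.
    rewrite VopAE EO -linearP; apply: generated_single; apply: PL => //; exact: PE.
Qed.

(** The functions with values in [P] correspond to a subspace of [T] that contains
    the translates of [P], and [translates] is injective. *)
Lemma generated_fibre c : P 0 -> generated (iota c) -> P c.
Proof.
move=> P0 /(_ [set v | exists2 f : dsum (coset pi ga) 'cV[C]_n.+1,
   translates iota f = v & forall mu, P (f mu)]) [].
- split=> [|a _ _ [f <- Pf] [g <- Pg]].
    exists 0; first by rewrite (linear_0 (translates_linear pi_inj iota (ga' := ga))).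
    by move=> mu; exact: P0.
  exists (a *: f + g); first exact: translates_linear.
  by move=> mu; exact: (PL a (Pf mu) (Pg mu)).
- move=> x d Pd; exists (dsingle (coset_translate pi ga x) d).
    exact: translates_single.
  by move=> mu; rewrite /= /delta; case: ifP.
move=> f fc Pf.
have e : f = dsingle (coset_translate pi ga 0) c.
  apply/eqP; rewrite -subr_eq0; apply/eqP.
  apply: (translates_inj pi_inj rho_neq0 iotaU iota_inj).
  set s := dsingle _ c; have -> : f - s = -1 *: s + f by rewrite scaleN1r addrC.
  have := translates_linear pi_inj iota (-1) s f => /= ->.
  by rewrite fc translates_single // Aop0 scaleN1r addNr.
have := Pf (ga + pi 0); rewrite e /= /delta eqxx; exact.
Qed.

End GeneratedSubmodule.

(** A stable subspace of the fibre generates a submodule of [T] of which it is the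
    fibre. *)
Lemma fibre_irreducible : irreducible_family (range E).
Proof.
move=> P P0 PL PO [c c0 Pc] d.
have PE x u : P u -> P (E x *m u) by apply: PO; exists x.
have [J0|JT] := Tsimple.2 _ (generated_submodule PL PE).
  have : generated P (iota c) by rewrite -[iota c]Aop0; exact: generated_single.
  by rewrite J0 /= => /iota_inj /eqP; rewrite (negPf c0).
by apply: (generated_fibre PL P0); rewrite JT.
Qed.

End Fibre.

(** * Comparison with the tensor modules *)

Lemma half_scale (F : numFieldType) (V : lmodType F) (a b c : F) (x y z : V) :
  2^-1 *: ((2 * a) *: x + b *: y + (2 * c) *: z) =
  a *: x + b *: (2^-1 *: y) + c *: z.
Proof.
by rewrite !scalerDr !scalerA !mulrA mulVf ?pnatr_eq0 // !mul1r [b * _]mulrC.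
Qed.

Section Comparison.
Variable R : realType.
Local Notation C := R[i].

Lemma half_poisson_quadE (la : plane R) (u : {mpoly C[2]}) :
  2^-1 *: poisson (quad la) u =
    (la 0 0 * (la 0 0 + 1)) *: ('X_0 * mderiv 1 u)
    + (la 0 0 * (la 0 1 + 1) + la 0 1 * (la 0 0 + 1)) *:
        (2^-1 *: ('X_1 * mderiv 1 u - 'X_0 * mderiv 0 u))
    + (la 0 1 * (la 0 1 + 1)) *: (- ('X_1 * mderiv 0 u)).
Proof.
rewrite -half_scale; congr (2^-1 *: _).
rewrite /poisson /quad !mderivM !mderiv_linform /linform !mxE.
rewrite -!mul_mpolyC !(mpolyCM, mpolyCD, mpolyCN, mpolyC1).
by ring.
Qed.

End Comparison.

(** * Classification of the fibres *)

(** The functions [q0] and [q1] are the coordinates of [pi]. *)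
Section Classification.
Variables (C : numClosedFieldType) (N n : nat).
Local Notation G := 'rV[int]_N.
Local Notation X := 'rV[C]_N.
Variables (q0 q1 : G -> C) (E : G -> 'M[C]_n.+1) (e0 : C).
Local Notation w x y := (q0 x * q1 y - q1 x * q0 y).
Local Notation r x := (q1 x - q0 x).
Hypothesis q0D : forall x y, q0 (x + y) = q0 x + q0 y.
Hypothesis q1D : forall x y, q1 (x + y) = q1 x + q1 y.
Hypothesis Ebr : forall x y, br (E x) (E y) =
  (w x y + r y - r x) *: E (x + y) - (w x y + r y) *: E y
  + (r x - w x y) *: E x.
Hypothesis E0 : E 0 = e0%:M.
Hypothesis r_neq0 : forall x, x != 0 -> r x != 0.
Hypothesis wr_neq0 : forall z b, b != 0 -> w z b + 2 * r b != 0.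
Hypothesis irrE : irreducible_family (range E).
Hypothesis w_neq0 : exists x y, w x y != 0.

Let wDl x y z : w (x + y) z = w x z + w y z.
Proof. by rewrite q0D q1D; ring. Qed.

Let wC x y : w x y = - w y x. Proof. by ring. Qed.

Let rD x y : r (x + y) = r x + r y.
Proof. by rewrite q0D q1D; ring. Qed.

Lemma fibre_degree_two : difs_vanish 3 E.
Proof.
have [m Em] : exists m, difs_vanish m E.
  apply: difs_vanish_generators => b; have [->|b0] := eqVneq b 0.
    by exists 1%N => x; apply: iter_dif_constant => y; rewrite addr0.
  exact: (iter_dif_eq0 (w := fun x y => w x y) (r := fun x => r x)
    wDl wC rD Ebr r_neq0 wr_neq0 b0).
exact: (difs_vanish3 (w := fun x y => w x y) (r := fun x => r x)
    wDl wC rD Ebr r_neq0 irrE Em).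
Qed.

Section Complexified.
Variables (L : G -> 'M[C]_n.+1) (B : G -> G -> 'M[C]_n.+1).
Hypothesis LD : forall x y, L (x + y) = L x + L y.
Hypothesis BC : forall x y, B x y = B y x.
Hypothesis BDl : forall x y z, B (x + y) z = B x z + B y z.
Hypothesis EE : forall x, E x = E 0 + L x + B x x.

Let p0 : X -> C := complexify (q0 : G -> C^o).
Let p1 : X -> C := complexify (q1 : G -> C^o).
Let L' : X -> 'M[C]_n.+1 := complexify L.
Let B' (u v : X) : 'M[C]_n.+1 := complexify (fun x => complexify (B x) v) u.
Local Notation pt := (@lattice_point C N).

Let p0L a u v : p0 (a *: u + v) = a * p0 u + p0 v.
Proof. exact: (complexify_linear (q0 : G -> C^o)). Qed.

Let p1L a u v : p1 (a *: u + v) = a * p1 u + p1 v.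
Proof. exact: (complexify_linear (q1 : G -> C^o)). Qed.

Let L'L a u v : L' (a *: u + v) = a *: L' u + L' v.
Proof. exact: complexify_linear. Qed.

Let B'L a u v s : B' (a *: u + v) s = a *: B' u s + B' v s.
Proof. exact: complexify_linear. Qed.

Let B'Lr a u v s : B' s (a *: u + v) = a *: B' s u + B' s v.
Proof.
rewrite /B' -complexify_linearl; congr (complexify _ s).
by apply/funext => x; exact: complexify_linear.
Qed.

Let p0pt x : p0 (pt x) = q0 x.
Proof. exact: (@complexify_lattice C N C^o q0 x q0D). Qed.

Let p1pt x : p1 (pt x) = q1 x.
Proof. exact: (@complexify_lattice C N C^o q1 x q1D). Qed.

Let L'pt x : L' (pt x) = L x.
Proof. exact: (@complexify_lattice C N _ L x LD). Qed.

Let B'pt x y : B' (pt x) (pt y) = B x y.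
Proof.
rewrite /B' complexify_lattice => [|x1 x2].
  by apply: complexify_lattice => y1 y2; rewrite BC BDl !(BC x).
rewrite -[complexify (B x1) _]scale1r -complexify_linearl.
by congr (complexify _ _); apply/funext => z; rewrite BDl scale1r.
Qed.

Let B'C u v : B' u v = B' v u.
Proof.
elim/lattice_point_ind: u v => [a u u' IH IH' v|x v].
  by rewrite B'L B'Lr IH IH'.
elim/lattice_point_ind: v => [a u u' IH IH'|y]; first by rewrite B'L B'Lr IH IH'.
by rewrite !B'pt BC.
Qed.

Let brL'L' u v : br (L' u) (L' v) =
  - (p0 u * p1 v - p1 u * p0 v) *: e0%:M
  - (p1 u - p0 u) *: L' v + (p1 v - p0 v) *: L' u.
Proof.
elim/lattice_point_ind: u v => [a u u' IH IH' v|x v].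
  by rewrite !(L'L, p0L, p1L) brDl brZl IH IH'; mx_ring.
elim/lattice_point_ind: v => [a u u' IH IH'|y].
  by rewrite !(L'L, p0L, p1L) brDr brZr IH IH'; mx_ring.
rewrite !(p0pt, p1pt, L'pt) -E0.
exact: (br_linear (w := fun x y => w x y) (r := fun x => r x)
  wDl wC rD Ebr LD BC BDl EE).
Qed.

Let brL'B' u v s : br (L' u) (B' v s) =
  - (p1 u - p0 u) *: B' v s + (p1 v - p0 v) *: B' u s + (p1 s - p0 s) *: B' u v.
Proof.
elim/lattice_point_ind: u v s => [a u u' IH IH' v s|x v s].
  by rewrite !(L'L, B'L, p0L, p1L) brDl brZl IH IH'; mx_ring.
elim/lattice_point_ind: v s => [a u u' IH IH' s|y s].
  by rewrite !(B'Lr, B'L, p0L, p1L) brDr brZr IH IH'; mx_ring.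
elim/lattice_point_ind: s => [a u u' IH IH'|z].
  by rewrite !(B'Lr, p0L, p1L) brDr brZr IH IH'; mx_ring.
rewrite !(p0pt, p1pt, L'pt, B'pt).
exact: (br_linear_quadratic (w := fun x y => w x y) (r := fun x => r x)
  wDl wC rD Ebr LD BC BDl EE).
Qed.

Let brB'B' u v s t : 2 *: br (B' u v) (B' s t) =
  (p0 u * p1 s - p1 u * p0 s) *: B' v t + (p0 u * p1 t - p1 u * p0 t) *: B' v s
  + (p0 v * p1 s - p1 v * p0 s) *: B' u t
  + (p0 v * p1 t - p1 v * p0 t) *: B' u s.
Proof.
elim/lattice_point_ind: u v s t => [a u u' IH IH' v s t|x v s t].
  by rewrite !(B'L, p0L, p1L) brDl brZl scalerDr scalerA mulrC -scalerA IH IH'; mx_ring.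
elim/lattice_point_ind: v s t => [a u u' IH IH' s t|y s t].
  by rewrite !(B'Lr, B'L, p0L, p1L) brDl brZl scalerDr scalerA mulrC -scalerA IH IH'; mx_ring.
elim/lattice_point_ind: s t => [a u u' IH IH' t|z t].
  by rewrite !(B'Lr, B'L, p0L, p1L) brDr brZr scalerDr scalerA mulrC -scalerA IH IH'; mx_ring.
elim/lattice_point_ind: t => [a u u' IH IH'|z'].
  by rewrite !(B'Lr, p0L, p1L) brDr brZr scalerDr scalerA mulrC -scalerA IH IH'; mx_ring.
rewrite !(p0pt, p1pt, B'pt).
exact: (br_quadratic (w := fun x y => w x y) (r := fun x => r x)
  wDl wC rD Ebr LD BC BDl EE).
Qed.

Let irrLB : irreducible_family
  [set A | (exists u, A = L' u) \/ (exists u v, A = B' u v)].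
Proof.
move=> P P0 PL PO; apply: irrE => // _ v [x _ <-] Pv.
rewrite EE !mulmxDl E0 mul_scalar_mx -addrA; apply: (PL _ _ _) => //.
rewrite -[L x *m v]scale1r; apply: (PL _ _ _); apply: (PO _ _) => //.
  by left; exists (pt x); rewrite L'pt.
by right; exists (pt x), (pt x); rewrite B'pt.
Qed.

(** Cramer's rule. *)
Let coordinate_vectors : exists u0 u1 : X,
  [/\ p0 u0 = 1, p1 u0 = 0, p0 u1 = 0 & p1 u1 = 1].
Proof.
have [x [y wxy]] := w_neq0; pose d := (w x y)^-1.
exists ((d * q1 y) *: pt x + (- (d * q1 x)) *: pt y).
exists ((- (d * q0 y)) *: pt x + (d * q0 x) *: pt y).
have pZ (p : X -> C) : (forall a u v, p (a *: u + v) = a * p u + p v) ->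
    forall a u, p (a *: u) = a * p u.
  move=> pL a u; have p00 : p 0 = 0.
    by have := pL (-1) 0 0; rewrite scaler0 addr0 mulN1r addNr.
  by have := pL a u 0; rewrite p00 !addr0.
rewrite !p0L !p1L !(pZ _ p0L) !(pZ _ p1L) !p0pt !p1pt.
have dw : d * w x y = 1 by rewrite mulVf.
by split; rewrite -?dw; ring.
Qed.

Lemma classification_of_expansion : exists (a b : C) (e h g : 'M[C]_n.+1),
  [/\ forall x, E x =
        ((q0 x + 1) * a + (q1 x + 1) * b)%:M
        + ((q0 x * (q0 x + 1)) *: e
           + (q0 x * (q1 x + 1) + q1 x * (q0 x + 1)) *: h
           + (q1 x * (q1 x + 1)) *: g),
      br e g = 2 *: h, br h e = - e, br h g = g &
      irreducible_family [set A | A = e \/ A = h \/ A = g]].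
Proof.
have [u0 [u1 [h0 h1 h2 h3]]] := coordinate_vectors.
have [a [b [e [h [g [He eg he hg irr]]]]]] :=
  reduction_to_sl2 p0L p1L L'L B'L B'C brL'L' brL'B' brB'B' h0 h1 h2 h3 irrLB.
exists a, b, e, h, g; split=> // x.
by have := He (pt x); rewrite !(p0pt, p1pt, L'pt, B'pt) -E0 -EE.
Qed.

End Complexified.

Lemma fibre_classification :
  exists (m : nat) (a b : C) (phi : {mpoly C[2]} -> 'cV[C]_n.+1),
  [/\ linear phi,
      forall x q, E x *m phi q = ((q0 x + 1) * a + (q1 x + 1) * b) *: phi q
        + phi ((q0 x * (q0 x + 1)) *: ('X_0 * mderiv 1 q)
           + (q0 x * (q1 x + 1) + q1 x * (q0 x + 1)) *:
               (2^-1 *: ('X_1 * mderiv 1 q - 'X_0 * mderiv 0 q))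
           + (q1 x * (q1 x + 1)) *: (- ('X_1 * mderiv 0 q))),
      forall q, q \is m.-homog -> phi q = 0 -> q = 0 &
      forall u, exists2 q, q \is m.-homog & phi q = u].
Proof.
have [L [B [LD BC BDl EE]]] := quadratic_expansion fibre_degree_two.
have [a [b [e [h [g [EQ eg he hg irr]]]]]] := classification_of_expansion LD BC BDl EE.
have [m [phi [phiL phie phih phig [phi_inj phi_surj]]]] :=
  sl2_irreducible_sym eg he hg irr.
exists m, a, b, phi; split=> // x q.
have phiZ c p : phi (c *: p) = c *: phi p.
  have z : phi 0 = 0 by have := phiL (-1) 0 0; rewrite scaler0 addr0 scaleN1r addNr.
  by have := phiL c p 0; rewrite z !addr0.
rewrite -addrA !phiL phie phih phiZ phig EQ !mulmxDl mul_scalar_mx -!scalemxAl.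
by rewrite -addrA.
Qed.

End Classification.

Section TensorComparison.
Variables (R : realType) (N : nat) (pi : {additive 'rV[int]_N -> plane R}).
Local Notation C := R[i].
Local Notation G := 'rV[int]_N.
Variable T : avModule pi.
Hypothesis pi_inj : injective pi.
Variables (m : nat) (ga : plane R) (j : {linear dhomog 2 C m -> T}).
Hypothesis Oj : forall x u, Oop x (j u) =
  symp (pi x + rho) (ga + rho) *: j u + j (2^-1 *: quad_act (pi x) u).

Definition tensor_translates (f : Mmod pi m ga) : T := translates j (ga' := ga) f.
Local Notation Psi := tensor_translates.

Lemma tensor_translates_linear : linear Psi.
Proof. exact: translates_linear. Qed.

Let Psi0 : Psi 0 = 0.
Proof. exact: (linear_0 tensor_translates_linear). Qed.
Let PsiD u v : Psi (u + v) = Psi u + Psi v.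
Proof. exact: (linear_D _ _ tensor_translates_linear). Qed.

Let PsiZ a f : Psi (a *: f) = a *: Psi f.
Proof. by have := tensor_translates_linear a f 0; rewrite Psi0 !addr0. Qed.

Lemma tensor_translates_single mu (Gmu : coset pi ga mu) x u :
  mu = ga + pi x -> Psi (dsingle Gmu u) = Aop x (j u).
Proof.
move=> E; rewrite -(translates_single pi_inj j (coset_translate pi ga x)).
by congr (translates j _); exact: dsingle_eq.
Qed.

Lemma tensor_translates_actA a f : Psi (actA a f) = actA a (Psi f).
Proof.
elim/dsum_ind: a => [|a b IHa IHb|la Gla a].
- by rewrite (linear_0 (actA_linearl f)) (linear_0 (actA_linearl _)) Psi0.
- rewrite (linear_D _ _ (actA_linearl f)) (linear_D _ _ (actA_linearl _)).
  by rewrite PsiD IHa IHb.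
have [y _ yE] := Gla.
rewrite (actZ_dsingle _ (coset_shift pi y)); last by rewrite yE opprK addrK.
rewrite !actAZ PsiZ; congr (_ *: _); rewrite -[RHS]/(Aop y (Psi f)).
elim/dsum_ind: f => [|f g IHf IHg|mu Gmu u].
- by rewrite (linear_0 (actA_linearr _)) Psi0 (linear_0 (Aop_linear y)).
- rewrite (linear_D _ _ (actA_linearr _)) !PsiD IHf IHg.
  by rewrite (linear_D _ _ (Aop_linear y)).
have [x _ xE] := Gmu.
rewrite (tensor_translates_single Gmu (x := x)); last by rewrite xE addrC subrK.
rewrite /= /M_actA bext_single (tensor_translates_single _ (x := y + x)).
  by rewrite AopD scale1r.
by rewrite raddfD xE addrAC subrK addrCA [ga + _]addrC subrK.
Qed.

Lemma tensor_translates_actV a f : Psi (actV a f) = actV a (Psi f).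
Proof.
elim/dsum_ind: a => [|a b IHa IHb|la Gla a].
- by rewrite (linear_0 (actV_linearl f)) (linear_0 (actV_linearl _)) Psi0.
- rewrite (linear_D _ _ (actV_linearl f)) (linear_D _ _ (actV_linearl _)).
  by rewrite PsiD IHa IHb.
have [y _ yE] := Gla.
rewrite (actZ_dsingle _ (in_lattice_pi pi y)); last by rewrite yE.
rewrite !actVZ PsiZ; congr (_ *: _); rewrite -[RHS]/(Vop y (Psi f)).
elim/dsum_ind: f => [|f g IHf IHg|mu Gmu u].
- by rewrite (linear_0 (actV_linearr _)) Psi0 (linear_0 (Vop_linear y)).
- rewrite (linear_D _ _ (actV_linearr _)) !PsiD IHf IHg.
  by rewrite (linear_D _ _ (Vop_linear y)).
have [x _ xE] := Gmu.
have muE : mu = ga + pi x by rewrite xE addrC subrK.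
rewrite (tensor_translates_single Gmu u muE).
rewrite /= /M_actV bext_single (tensor_translates_single _ (x := y + x)); last first.
  by rewrite raddfD muE addrCA.
rewrite VopAE Oj; congr (Aop _ _).
rewrite scale1r /M_coef linearD linearZ /= addrA -scalerDl; congr (_ *: _ + _).
by rewrite muE -symp_shiftl -sympDr [ga + pi x]addrC -addrA.
Qed.

(** The formula [tensor_translates] defines the inverse of the isomorphism. *)
Lemma av_iso_of_fibre ga0 : (forall x, x != 0 -> lat_rho pi x != 0) ->
    graded_by T ga0 -> (forall u, weight_space ga0 (j u)) ->
    (forall u, j u = 0 -> u = 0) ->
    (forall v, weight_space ga0 v -> exists u, v = j u) ->
  av_iso T (Mmod pi m ga).
Proof.
move=> rho_neq0 Tga jU j_inj j_surj.
have Psi_inj : injective Psi.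
  move=> f g fg; apply/eqP; rewrite -subr_eq0; apply/eqP.
  apply: (translates_inj pi_inj rho_neq0 jU j_inj).
  have -> : f - g = -1 *: g + f by rewrite scaleN1r addrC.
  by apply: etrans (tensor_translates_linear (-1) g f) _; rewrite fg scaleN1r addNr.
have [inv invK] : exists inv : T -> Mmod pi m ga, forall v, Psi (inv v) = v.
  have [inv invK] := choice (translates_surj pi_inj Tga ga j_surj).
  by exists inv => v; exact: invK.
have PsiK : cancel Psi inv by move=> f; apply: Psi_inj; exact: invK.
have inv_lin : linear inv.
  by move=> c u v; apply: Psi_inj; rewrite tensor_translates_linear !invK.
have invA c v : inv (actA c v) = actA c (inv v).
  by apply: Psi_inj; rewrite tensor_translates_actA !invK.
have invV c v : inv (actV c v) = actV c (inv v).
  by apply: Psi_inj; rewrite tensor_translates_actV !invK.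
exists (HB.pack inv (GRing.isLinear.Build _ _ _ _ _ inv_lin)
  : {linear T -> Mmod pi m ga}).
by split; [exists Psi | exact: invA | exact: invV].
Qed.

End TensorComparison.

Section Plane.
Variable R : realType.

Lemma symp_eq0_collinear (u v : plane R) :
  u != 0 -> symp u v = 0 -> exists c, v = c *: u.
Proof.
move=> u0 /eqP; rewrite /symp subr_eq0 => /eqP uv.
have [u00|u00] := eqVneq (u 0 0) 0.
  have u01 : u 0 1 != 0.
    apply: contraNneq u0 => u01; apply/eqP/rowP => k; rewrite mxE.
    by have [->|->] := ord2_cases k.
  exists (v 0 1 / u 0 1); apply/rowP => k; rewrite mxE.
  have [->|->] := ord2_cases k; last by rewrite divfK.
  by apply: (mulfI u01); rewrite u00 -uv u00 !(mul0r, mulr0).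
exists (v 0 0 / u 0 0); apply/rowP => k; rewrite mxE.
have [->|->] := ord2_cases k; first by rewrite divfK.
by apply: (mulfI u00); rewrite uv mulrA mulrCA divff ?mulr1 // mulrC.
Qed.

Lemma lat_symp_neq0 N (pi : {additive 'rV[int]_N -> plane R}) :
    (forall u : plane R, ~ (forall x, exists c, pi x = c *: u)) ->
  exists x y, lat_symp pi x y != 0.
Proof.
move=> pi_line; apply: contrapT => no.
have [x x0] : exists x, pi x != 0.
  apply: contrapT => z; apply: (pi_line 0) => x; exists 0.
  by rewrite scaler0; apply: contrapT => /eqP x0; apply: z; exists x.
apply: (pi_line (pi x)) => y; apply: symp_eq0_collinear => //.
by apply/eqP; apply: contraT => xy; case: no; exists x, y.
Qed.

End Plane.

(** * The classification theorem *)

Theorem theorem3p16 (R : realType) (N : nat)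
    (pi : {additive 'rV[int]_N -> plane R})
    (N_gt1 : (1 < N)%N)
    (pi_inj : injective pi)
    (pi_rho : ~ (forall x, exists c : R[i], pi x = c *: rho))
    (pi_2rho : ~ in_lattice pi (2 *: rho))
    (pi_line : forall u : plane R, ~ (forall x, exists c : R[i], pi x = c *: u))
    (pi_symp : forall al be : plane R,
       in_lattice pi al -> in_lattice pi be -> be != 0 ->
       symp (al + 2 *: rho) be != 0)
    (T : avModule pi)
    (T_graded : exists ga : plane R, graded_by T ga /\ finite_rank T ga)
    (T_simple : av_simple T) :
  exists (n : nat) (ga : plane R), av_iso T (Mmod pi n ga).
Proof.
have [ga [Tga Tfin]] := T_graded.
pose q0 x := pi x 0 0; pose q1 x := pi x 0 1.
have rhoE x : lat_rho pi x = q1 x - q0 x by rewrite /lat_rho /symp !mxE !mul1r.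
have sympE x y : lat_symp pi x y = q0 x * q1 y - q1 x * q0 y by [].
have q0D x y : q0 (x + y) = q0 x + q0 y by rewrite /q0 raddfD mxE.
have q1D x y : q1 (x + y) = q1 x + q1 y by rewrite /q1 raddfD mxE.
have pi_neq0 x : x != 0 -> pi x != 0.
  by apply: contra_neq => x0; apply: pi_inj; rewrite x0 raddf0.
have form_neq0 z b : b != 0 -> lat_symp pi z b + 2 * lat_rho pi b != 0.
  move=> b0.
  have := pi_symp _ _ (in_lattice_pi pi z) (in_lattice_pi pi b) (pi_neq0 b b0).
  by rewrite sympDl /lat_symp /lat_rho; apply: contra_neq => <-; congr (_ + _);
    rewrite /symp !mxE; ring.
have rho_neq0 x : x != 0 -> lat_rho pi x != 0.
  move=> /(form_neq0 0); rewrite /lat_symp raddf0 {1}/symp !mxE !mul0r subrr add0r.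
  by rewrite mulf_eq0 pnatr_eq0.
have [n [iota [iotaU iota_inj iota_surj]]] :=
  fibre_basis Tga Tfin T_simple.
have matrixO x : exists M : 'M[R[i]]_n.+1,
    forall c, Oop x (iota c) = iota (M *m c).
  apply: operator_matrix => [a u v|c]; first exact: Oop_linear.
  by have [d dE] := iota_surj _ (Oop_weight x (iotaU c)); exists d.
have [E EO] := choice matrixO.
have irrE := fibre_irreducible pi_inj rho_neq0 T_simple iotaU iota_inj EO.
have [m [a [b [phi [phiL phiE phi_inj phi_surj]]]]] :
  exists (m : nat) (a b : R[i]) (phi : {mpoly R[i][2]} -> 'cV[R[i]]_n.+1),
  [/\ linear phi,
      forall x q, E x *m phi q = ((q0 x + 1) * a + (q1 x + 1) * b) *: phi q
        + phi (2^-1 *: poisson (quad (pi x)) q),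
      forall q, q \is m.-homog -> phi q = 0 -> q = 0 &
      forall u, exists2 q, q \is m.-homog & phi q = u].
  have Ebr x y : br (E x) (E y) =
      (q0 x * q1 y - q1 x * q0 y + (q1 y - q0 y) - (q1 x - q0 x)) *: E (x + y)
      - (q0 x * q1 y - q1 x * q0 y + (q1 y - q0 y)) *: E y
      + (q1 x - q0 x - (q0 x * q1 y - q1 x * q0 y)) *: E x.
    by rewrite -!rhoE -!sympE; exact: (fibre_br iota_inj EO).
  have r0 x : x != 0 -> q1 x - q0 x != 0 by rewrite -rhoE; exact: rho_neq0.
  have wr0 z b : b != 0 -> q0 z * q1 b - q1 z * q0 b + 2 * (q1 b - q0 b) != 0.
    by rewrite -rhoE -sympE; exact: form_neq0.
  have [m [a [b [phi [phiL phiE phi_inj phi_surj]]]]] := fibre_classification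
    q0D q1D Ebr (fibre0 iotaU iota_inj EO) r0 wr0 irrE (lat_symp_neq0 pi_line).
  exists m, a, b, phi; split=> // x q; rewrite phiE; congr (_ + phi _).
  exact/esym/half_poisson_quadE.
(* the weight for which [symp v (ga' + rho)] is [v 0 0 * a + v 0 1 * b] *)
pose ga' : plane R := \row_k (if k == 0 then - b - 1 else a - 1).
have jL : linear (fun u : dhomog 2 R[i] m => iota (phi (mpoly_of_dhomog u))).
  by move=> c u v; rewrite [mpoly_of_dhomog _]linearP phiL linearP.
pose j : {linear dhomog 2 R[i] m -> T} := HB.pack
  (fun u : dhomog 2 R[i] m => iota (phi (mpoly_of_dhomog u)))
  (GRing.isLinear.Build _ _ _ _ _ jL).
have jU u : weight_space ga (j u) by exact: iotaU.
have j_inj u : j u = 0 -> u = 0.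
  move=> /iota_inj /(phi_inj _ (dhomog_is_dhomog u)) u0.
  exact/val_inj.
have j_surj v : weight_space ga v -> exists u, v = j u.
  move=> /iota_surj [c ->]; have [q hq <-] := phi_surj c.
  by exists (DHomog hq).
have Oj x u : Oop x (j u) =
    symp (pi x + rho) (ga' + rho) *: j u + j (2^-1 *: quad_act (pi x) u).
  rewrite [LHS]EO phiE linearD; congr (_ + _).
  rewrite linearZ /=; congr (_ *: _).
  by rewrite /symp !mxE /=; rewrite -/(q0 x) -/(q1 x); ring.
exists m, ga'; exact: (av_iso_of_fibre pi_inj Oj rho_neq0 Tga).
Qed.
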